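(* The spaces $\mathcal{WH}^\circ$ and $\mathcal{WBH}^\circ$ are $h$-equal but not homotopy equivalent; likewise the compact spaces $\mathcal{WH}$ and $\mathcal{WBH}$ are $h$-equal but not homotopy equivalent.
   Context: $X=_hY$ ($h$-equal) means there exist maps $f:X\to Y,\ g:Y\to X$ with $g\circ f\simeq\mathrm{id}_X$ and maps $f':Y\to X,\ g':X\to Y$ with $g'\circ f'\simeq\mathrm{id}_Y$. Double broom $\mathcal{B}\subset\mathbb{R}^2$: $v=(0,0)$, $a_0=(0,1)$, $b_0=(0,-1)$, $a_n=(1/n,0)$, $b_n=(-1/n,0)$ ($n\ge1$), $\mathcal{B}=[v,a_0]\cup[v,b_0]\cup\bigcup_{n\ge1}([a_n,a_0]\cup[b_n,b_0])$ with center $v$. Hairy disk $\mathcal{H}$: the closed unit disk $D^2$ with center $c$, a countable dense subset $M=\{m_i\}$ of $\partial D^2$, and for each $i$ a copy $\mathcal{B}_{m_i}$ of $\mathcal{B}$ attached by its center at $m_i$, pairwise disjoint, meeting $D^2$ only in $m_i$, diameters tending to $0$. For disjoint $X,Y\subset\mathbb{R}^N$, $X\curlyvee_{x,y}Y=X\cup[x,y]\cup Y$ with $[x,y]$ an arc from $x\in X$ to $y\in Y$ whose interior misses $X\cup Y$. With $c(k)=(-1/k,0,0)$ and $\mathcal{H}(k)$ a copy of $\mathcal{H}$ of diameter $1/k$ in the plane $\{x=-1/k\}$ centered at $c(k)$: $\mathcal{WH}^\circ=\mathcal{H}(1)\curlyvee_{c(1),c(2)}\mathcal{H}(2)\curlyvee_{c(2),c(3)}\cdots$,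 $\mathcal{WBH}^\circ=\mathcal{B}\curlyvee_{b,c'(1)}\mathcal{H}'(1)\curlyvee_{c'(1),c'(2)}\mathcal{H}'(2)\cdots$ (with $b$ the center of the extra broom, $\mathcal{H}'(k),c'(k)$ analogous factors), $\mathcal{WH}=\mathcal{WH}^\circ\cup\{(0,0,0)\}$, $\mathcal{WBH}=\mathcal{WBH}^\circ\cup\{(0,0,0)\}$. *)

(* Defs.v *)
From Stdlib Require Import Reals Lra.
Open Scope R_scope.

Definition pt2 : Type := (R * R)%type.
Definition pt3 : Type := (R * R * R)%type.

Definition d2 (p q : pt2) : R :=
  sqrt ((fst p - fst q) ^ 2 + (snd p - snd q) ^ 2).

Definition d3 (p q : pt3) : R :=
  let '(x1, y1, z1) := p in let '(x2, y2, z2) := q in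
  sqrt ((x1 - x2) ^ 2 + (y1 - y2) ^ 2 + (z1 - z2) ^ 2).

Definition cont_on {T U : Type} (dT : T -> T -> R) (dU : U -> U -> R)
  (X : T -> Prop) (f : T -> U) : Prop :=
  forall x, X x -> forall eps, 0 < eps ->
    exists delta, 0 < delta /\
      forall y, X y -> dT x y < delta -> dU (f x) (f y) < eps.

Definition image {T U : Type} (f : T -> U) (X : T -> Prop) : U -> Prop :=
  fun y => exists x, X x /\ y = f x.

Definition embedding2 (A : pt2 -> Prop) (f : pt2 -> pt2) : Prop :=
  cont_on d2 d2 A f /\
  exists g : pt2 -> pt2, cont_on d2 d2 (image f A) g /\
    forall p, A p -> g (f p) = p.

Definition cmap (X Y : pt3 -> Prop) (f : pt3 -> pt3) : Prop :=
  (forall x, X x -> Y (f x)) /\ cont_on d3 d3 X f.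

Definition homotopic (X Y : pt3 -> Prop) (f g : pt3 -> pt3) : Prop :=
  exists H : R -> pt3 -> pt3,
    (forall t x, 0 <= t <= 1 -> X x -> Y (H t x)) /\
    (forall t x, 0 <= t <= 1 -> X x -> forall eps, 0 < eps ->
       exists delta, 0 < delta /\
         forall t' y, 0 <= t' <= 1 -> X y -> Rabs (t - t') < delta ->
           d3 x y < delta -> d3 (H t x) (H t' y) < eps) /\
    (forall x, X x -> H 0 x = f x /\ H 1 x = g x).

Definition compose (g f : pt3 -> pt3) : pt3 -> pt3 := fun x => g (f x).

Definition h_equal (X Y : pt3 -> Prop) : Prop :=
  (exists f g, cmap X Y f /\ cmap Y X g /\ homotopic X X (compose g f) (fun x => x)) /\
  (exists f' g', cmap Y X f' /\ cmap X Y g' /\ homotopic Y Y (compose g' f') (fun x => x)).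

Definition homotopy_equivalent (X Y : pt3 -> Prop) : Prop :=
  exists f g, cmap X Y f /\ cmap Y X g /\
    homotopic X X (compose g f) (fun x => x) /\
    homotopic Y Y (compose f g) (fun y => y).

Definition seg2 (p q r : pt2) : Prop :=
  exists t, 0 <= t <= 1 /\
    r = ((1 - t) * fst p + t * fst q, (1 - t) * snd p + t * snd q).

(** a_n = (1/n,0), b_n = (-1/n,0) for n >= 1, written with n = S k. *)
Definition broom (r : pt2) : Prop :=
  seg2 (0, 0) (0, 1) r \/ seg2 (0, 0) (0, -1) r \/
  (exists k : nat, seg2 (/ INR (S k), 0) (0, 1) r) \/
  (exists k : nat, seg2 (- / INR (S k), 0) (0, -1) r).

Definition disk2 (p : pt2) : Prop := fst p ^ 2 + snd p ^ 2 <= 1.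
Definition circle2 (p : pt2) : Prop := fst p ^ 2 + snd p ^ 2 = 1.

Definition is_hairy_disk (H : pt2 -> Prop) : Prop :=
  exists (m : nat -> pt2) (e : nat -> pt2 -> pt2),
    (forall i, circle2 (m i)) /\
    (forall p, circle2 p -> forall eps, 0 < eps -> exists i, d2 (m i) p < eps) /\
    (forall i, embedding2 broom (e i)) /\
    (forall i, e i (0, 0) = m i) /\
    (forall i j p q, i <> j -> broom p -> broom q -> e i p <> e j q) /\
    (forall i p, broom p -> disk2 (e i p) -> e i p = m i) /\
    (forall eps, 0 < eps -> exists N, forall i, (N <= i)%nat ->
       forall p q, broom p -> broom q -> d2 (e i p) (e i q) < eps) /\
    (forall r, H r <-> disk2 r \/ exists i p, broom p /\ r = e i p).

Definition is_diameter (H : pt2 -> Prop) (D : R) : Prop :=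
  is_lub (fun r => exists p q, H p /\ H q /\ r = d2 p q) D.

(** H(k), k = S n: the copy of H scaled to diameter 1/k, in the plane
    {x = -1/k}, with the disk center c sent to c(k) = (-1/k,0,0). *)
Definition Hcopy (H : pt2 -> Prop) (D : R) (n : nat) (r : pt3) : Prop :=
  exists p, H p /\
    r = (- / INR (S n), / (INR (S n) * D) * fst p, / (INR (S n) * D) * snd p).

(** The arcs [c(k), c(k+1)] are the straight segments of the x-axis; their
    union is {(x,0,0) | -1 <= x < 0}. *)
Definition WHo (H : pt2 -> Prop) (D : R) (r : pt3) : Prop :=
  (exists n, Hcopy H D n r) \/
  (exists x, -1 <= x < 0 /\ r = (x, 0, 0)).

(** The extra broom lies in the plane {x = -2} with center b = (-2,0,0),
    joined to c'(1) = c(1) = (-1,0,0) by the segment [b, c(1)]. *)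
Definition WBHo (H : pt2 -> Prop) (D : R) (r : pt3) : Prop :=
  (exists p, broom p /\ r = (-2, fst p, snd p)) \/
  (exists n, Hcopy H D n r) \/
  (exists x, -2 <= x < 0 /\ r = (x, 0, 0)).

Definition WH (H : pt2 -> Prop) (D : R) (r : pt3) : Prop :=
  WHo H D r \/ r = (0, 0, 0).

Definition WBH (H : pt2 -> Prop) (D : R) (r : pt3) : Prop :=
  WBHo H D r \/ r = (0, 0, 0).

(* Main.v *)
From Stdlib Require Import Reals Lra Lia Psatz Rgeom ClassicalEpsilon.
From Stdlib Require Import FunctionalExtensionality PropExtensionality.
From Coquelicot Require Import Compactness.
Require Import Defs.
Open Scope R_scope.

(** The centre of a broom cannot be moved by a homotopy of the identity of a space carrying the
    broom as a whisker: while the centre stays close to its place, the ends [a_n] and [b_n] must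
    stay on their hairs, so the limit lies in the upper and in the lower cone at once. If
    moreover [g o f] is homotopic to the identity, then [f] must send the centre to a broom
    centre: near any other point all points can be pushed along paths to a common point, and
    mapping such paths back by [g] would join the hairs of [a_n] and [b_n] near the centre. So a
    homotopy equivalence matches the broom centres of the two spaces. The centre of the extra
    broom is isolated among the centres, whereas those on the boundary circles are not.

    Conversely the smaller space is a retract of the larger one, and the larger one is mapped
    to the smaller one by shifting every disk to the next and sending the extra broom to a
    broom of the first disk, onto which the first hairy disk retracts. *)

(** * Pointwise continuity *)

(** Broom centres are dense on each boundary circle, so every neighbourhood of a boundary point
    contains whole brooms. Their centres cannot be moved, hence no homotopy contracts such a
    neighbourhood to a point, even when the boundary point itself carries no broom. Continuity of
    the pushing in the starting point is therefore demanded only at the point in question: elsewhere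
    each point may follow a path picked by choice, and the smallness of nearby brooms gives
    continuity at that single point. The rigidity argument needs no more, since it only compares
    hair ends with the centre to which they converge. The brooms of a hairy disk are arbitrary
    topological copies, not similar ones. All broom geometry is thus done in the model broom and
    transported by an embedding together with a retraction of the whole space to that broom. *)

Definition cont_at {T U : Type} (dT : T -> T -> R) (dU : U -> U -> R)
  (X : T -> Prop) (f : T -> U) (x : T) : Prop :=
  forall eps, 0 < eps -> exists delta, 0 < delta /\
    forall y, X y -> dT x y < delta -> dU (f x) (f y) < eps.

Lemma cont_at_comp {T U V : Type} (dT : T -> T -> R) (dU : U -> U -> R)
  (dV : V -> V -> R) (X : T -> Prop) (Y : U -> Prop) (f : T -> U) (g : U -> V) x :
  cont_at dT dU X f x -> (forall y, X y -> Y (f y)) ->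
  cont_at dU dV Y g (f x) -> cont_at dT dV X (fun y => g (f y)) x.
Proof.
  intros Hf HXY Hg eps He. destruct (Hg eps He) as [d [Hd Hg']].
  destruct (Hf d Hd) as [d' [Hd' Hf']]. exists d'; split; auto.
Qed.

Lemma cont_at_eq_near {T U : Type} (dT : T -> T -> R) (dU : U -> U -> R)
  (X : T -> Prop) (f h : T -> U) x r :
  cont_at dT dU X h x -> 0 < r -> f x = h x ->
  (forall y, X y -> dT x y < r -> f y = h y) -> cont_at dT dU X f x.
Proof.
  intros Hh Hr H0 Heq eps He. destruct (Hh eps He) as [d [Hd H1]].
  exists (Rmin d r). split. { now apply Rmin_pos. }
  intros y Hy Hxy. rewrite H0, Heq; auto.
  - apply H1; auto. eapply Rlt_le_trans; [exact Hxy | apply Rmin_l].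
  - eapply Rlt_le_trans; [exact Hxy | apply Rmin_r].
Qed.

Lemma cont_at_eq {T U : Type} (dT : T -> T -> R) (dU : U -> U -> R)
  (X : T -> Prop) (f h : T -> U) x :
  X x -> cont_at dT dU X h x -> (forall y, X y -> f y = h y) -> cont_at dT dU X f x.
Proof.
  intros Hx Hh Heq. apply cont_at_eq_near with (h := h) (r := 1); auto; lra.
Qed.

Lemma cont_at_subset {T U : Type} (dT : T -> T -> R) (dU : U -> U -> R)
  (X X' : T -> Prop) (f : T -> U) x :
  cont_at dT dU X f x -> (forall y, X' y -> X y) -> cont_at dT dU X' f x.
Proof.
  intros H HX eps He. destruct (H eps He) as [d [Hd H1]]. exists d; split; auto.
Qed.

Lemma cont_at_id {T : Type} (d : T -> T -> R) (X : T -> Prop) x :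
  cont_at d d X (fun y => y) x.
Proof. intros eps He. exists eps; split; auto. Qed.

(** * Continuity of real-valued functions *)

Definition dR (x y : R) : R := Rabs (x - y).

Section RealValued.
Context {T : Type} (d : T -> T -> R) (X : T -> Prop).

Lemma cont_const (c : R) x : cont_at d dR X (fun _ => c) x.
Proof.
  intros eps He. exists 1. split; [lra|]. intros. unfold dR.
  rewrite Rminus_diag, Rabs_R0; auto.
Qed.

Lemma cont_plus f g x : cont_at d dR X f x -> cont_at d dR X g x ->
  cont_at d dR X (fun y => f y + g y) x.
Proof.
  intros Hf Hg eps He.
  destruct (Hf (eps / 2)) as [d1 [Hd1 H1]]; [lra|].
  destruct (Hg (eps / 2)) as [d2 [Hd2 H2]]; [lra|].
  exists (Rmin d1 d2). split. { now apply Rmin_pos. }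
  intros y Hy Hxy.
  assert (A := H1 y Hy (Rlt_le_trans _ _ _ Hxy (Rmin_l _ _))).
  assert (B := H2 y Hy (Rlt_le_trans _ _ _ Hxy (Rmin_r _ _))).
  unfold dR in *.
  replace (f x + g x - (f y + g y)) with ((f x - f y) + (g x - g y)) by ring.
  eapply Rle_lt_trans; [apply Rabs_triang | lra].
Qed.

Lemma cont_real_fun (h : R -> R) f x : continuity_pt h (f x) ->
  cont_at d dR X f x -> cont_at d dR X (fun y => h (f y)) x.
Proof.
  intros Hh Hf eps He. destruct (Hh eps He) as [a [Ha H1]].
  destruct (Hf a Ha) as [b [Hb H2]]. exists b. split; auto.
  intros y Hy Hxy. unfold dR.
  (* [continuity_pt] is a limit over points different from [f x], so equality is treated apart. *)
  destruct (Req_dec (f x) (f y)) as [E | E].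
  - rewrite E, Rminus_diag, Rabs_R0; auto.
  - rewrite Rabs_minus_sym. apply (H1 (f y)). split.
    + split; [exact I | exact E].
    + simpl. unfold Rdist. rewrite Rabs_minus_sym. now apply H2.
Qed.

Lemma cont_scal c f x : cont_at d dR X f x -> cont_at d dR X (fun y => c * f y) x.
Proof.
  intros Hf. apply (cont_real_fun (fun z => c * z)); auto.
  apply derivable_continuous_pt. apply derivable_pt_scal, derivable_pt_id.
Qed.

Lemma cont_opp f x : cont_at d dR X f x -> cont_at d dR X (fun y => - f y) x.
Proof.
  intros Hf. apply (cont_real_fun (fun z => - z)); auto.
  apply derivable_continuous_pt. apply derivable_pt_opp, derivable_pt_id.
Qed.

Lemma cont_minus f g x : cont_at d dR X f x -> cont_at d dR X g x ->
  cont_at d dR X (fun y => f y - g y) x.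
Proof. intros. apply cont_plus; auto. now apply cont_opp. Qed.

Lemma cont_ext f g x : cont_at d dR X f x -> (forall y, f y = g y) ->
  cont_at d dR X g x.
Proof.
  intros Hf E eps He. destruct (Hf eps He) as [a [Ha H1]].
  exists a. split; auto. intros. rewrite <- !E. auto.
Qed.

Lemma cont_mult f g x : cont_at d dR X f x -> cont_at d dR X g x ->
  cont_at d dR X (fun y => f y * g y) x.
Proof.
  intros Hf Hg.
  (* Polarization reduces the product to squares. *)
  apply cont_ext with
    (f := fun y => / 4 * (Rsqr (f y + g y) - Rsqr (f y - g y))).
  2: { intros y. unfold Rsqr. field. }
  apply cont_scal, cont_minus; apply (cont_real_fun Rsqr);
    try (apply derivable_continuous_pt, derivable_pt_Rsqr);
    [now apply cont_plus | now apply cont_minus].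
Qed.

Lemma cont_inv f x : f x <> 0 -> cont_at d dR X f x ->
  cont_at d dR X (fun y => / f y) x.
Proof.
  intros Hn Hf. apply (cont_real_fun Rinv); auto.
  apply (continuity_pt_inv (fun z => z)); auto.
  apply derivable_continuous_pt, derivable_pt_id.
Qed.

Lemma cont_abs f x : cont_at d dR X f x -> cont_at d dR X (fun y => Rabs (f y)) x.
Proof. intros. apply (cont_real_fun Rabs); auto. apply Rcontinuity_abs. Qed.

Lemma cont_max f g x : cont_at d dR X f x -> cont_at d dR X g x ->
  cont_at d dR X (fun y => Rmax (f y) (g y)) x.
Proof.
  intros Hf Hg.
  apply cont_ext with (f := fun y => / 2 * (f y + g y + Rabs (f y - g y))).
  - apply cont_scal, cont_plus; [now apply cont_plus | now apply cont_abs, cont_minus].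
  - intros y. unfold Rmax, Rabs. destruct Rle_dec, Rcase_abs; lra.
Qed.

Lemma cont_min f g x : cont_at d dR X f x -> cont_at d dR X g x ->
  cont_at d dR X (fun y => Rmin (f y) (g y)) x.
Proof.
  intros Hf Hg.
  apply cont_ext with (f := fun y => / 2 * (f y + g y - Rabs (f y - g y))).
  - apply cont_scal, cont_minus; [now apply cont_plus | now apply cont_abs, cont_minus].
  - intros y. unfold Rmin, Rabs. destruct Rle_dec, Rcase_abs; lra.
Qed.

End RealValued.

(** * Euclidean metrics and coordinates *)

Definition p1 (r : pt3) : R := fst (fst r).
Definition p2 (r : pt3) : R := snd (fst r).
Definition p3 (r : pt3) : R := snd r.

Lemma sqrt_le_of_sq x y : 0 <= y -> x <= y ^ 2 -> sqrt x <= y.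
Proof.
  intros Hy H. rewrite <- (sqrt_pow2 y Hy). now apply sqrt_le_1_alt.
Qed.

Lemma le_sqrt_of_sq x y : x ^ 2 <= y -> Rabs x <= sqrt y.
Proof.
  intros H. rewrite <- (sqrt_pow2 (Rabs x)); [|apply Rabs_pos].
  apply sqrt_le_1_alt. now rewrite pow2_abs.
Qed.

Lemma norm2_triangle a b c e :
  sqrt ((a + b) ^ 2 + (c + e) ^ 2) <= sqrt (a ^ 2 + c ^ 2) + sqrt (b ^ 2 + e ^ 2).
Proof.
  assert (H := triangle 0 0 (a + b) (c + e) a c). unfold dist_euc, Rsqr in H.
  replace ((a + b) ^ 2 + (c + e) ^ 2)
    with ((0 - (a + b)) * (0 - (a + b)) + (0 - (c + e)) * (0 - (c + e))) by ring.
  replace (a ^ 2 + c ^ 2) with ((0 - a) * (0 - a) + (0 - c) * (0 - c)) by ring.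
  replace (b ^ 2 + e ^ 2)
    with ((a - (a + b)) * (a - (a + b)) + (c - (c + e)) * (c - (c + e))) by ring.
  exact H.
Qed.

Lemma d2_triangle (p q r : pt2) : d2 p r <= d2 p q + d2 q r.
Proof.
  unfold d2.
  replace (fst p - fst r) with ((fst p - fst q) + (fst q - fst r)) by ring.
  replace (snd p - snd r) with ((snd p - snd q) + (snd q - snd r)) by ring.
  apply norm2_triangle.
Qed.

Lemma d2_sym (p q : pt2) : d2 p q = d2 q p.
Proof. unfold d2. f_equal. ring. Qed.

Lemma d2_pos (p q : pt2) : 0 <= d2 p q.
Proof. apply sqrt_pos. Qed.

Lemma d2_fst (p q : pt2) : Rabs (fst p - fst q) <= d2 p q.
Proof. apply le_sqrt_of_sq. assert (H := pow2_ge_0 (snd p - snd q)). lra. Qed.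

Lemma d2_snd (p q : pt2) : Rabs (snd p - snd q) <= d2 p q.
Proof. apply le_sqrt_of_sq. assert (H := pow2_ge_0 (fst p - fst q)). lra. Qed.

Lemma d2_le (p q : pt2) : d2 p q <= Rabs (fst p - fst q) + Rabs (snd p - snd q).
Proof.
  apply sqrt_le_of_sq.
  - assert (A := Rabs_pos (fst p - fst q)). assert (B := Rabs_pos (snd p - snd q)). lra.
  - rewrite <- (pow2_abs (fst p - fst q)), <- (pow2_abs (snd p - snd q)).
    assert (A := Rabs_pos (fst p - fst q)). assert (B := Rabs_pos (snd p - snd q)). nra.
Qed.

Lemma d2_refl p : d2 p p = 0.
Proof.
  apply Rle_antisym; [|apply d2_pos]. eapply Rle_trans; [apply d2_le|].
  rewrite !Rminus_diag, Rabs_R0. lra.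
Qed.

Lemma d2_eq (p q : pt2) : d2 p q <= 0 -> p = q.
Proof.
  intros H. assert (A := d2_fst p q). assert (B := d2_snd p q).
  destruct p as [x y], q as [x' y']; simpl in *.
  f_equal; apply Rminus_diag_uniq.
  - destruct (Req_dec (x - x') 0) as [E|E]; auto. apply Rabs_pos_lt in E. lra.
  - destruct (Req_dec (y - y') 0) as [E|E]; auto. apply Rabs_pos_lt in E. lra.
Qed.

(** Splitting space as plane times line lets the triangle inequality in space follow from
    [norm2_triangle], applied to a planar distance and the last coordinate. *)
Lemma d3_eq_norm (p q : pt3) :
  d3 p q = sqrt (d2 (fst p) (fst q) ^ 2 + (p3 p - p3 q) ^ 2).
Proof.
  destruct p as [[x y] z], q as [[x' y'] z']. unfold d3, d2, p3; cbn [fst snd].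
  rewrite pow2_sqrt; auto.
  assert (A := pow2_ge_0 (x - x')). assert (B := pow2_ge_0 (y - y')). lra.
Qed.

Lemma d3_triangle (p q r : pt3) : d3 p r <= d3 p q + d3 q r.
Proof.
  rewrite !d3_eq_norm.
  eapply Rle_trans; [|apply norm2_triangle].
  apply sqrt_le_1_alt.
  replace (p3 p - p3 q + (p3 q - p3 r)) with (p3 p - p3 r) by ring.
  apply Rplus_le_compat_r. apply pow_incr. split; [apply d2_pos | apply d2_triangle].
Qed.

Lemma d3_sym (p q : pt3) : d3 p q = d3 q p.
Proof. rewrite !d3_eq_norm, d2_sym. f_equal. ring. Qed.

Lemma d3_fst (p q : pt3) : d2 (fst p) (fst q) <= d3 p q.
Proof.
  rewrite d3_eq_norm.
  apply (Rle_trans _ (Rabs (d2 (fst p) (fst q)))); [apply Rle_abs|].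
  apply le_sqrt_of_sq. assert (H := pow2_ge_0 (p3 p - p3 q)). lra.
Qed.

Lemma d3_p1 (p q : pt3) : Rabs (p1 p - p1 q) <= d3 p q.
Proof. eapply Rle_trans; [apply d2_fst | apply d3_fst]. Qed.

Lemma d3_p2 (p q : pt3) : Rabs (p2 p - p2 q) <= d3 p q.
Proof. eapply Rle_trans; [apply d2_snd | apply d3_fst]. Qed.

Lemma d3_p3 (p q : pt3) : Rabs (p3 p - p3 q) <= d3 p q.
Proof.
  rewrite d3_eq_norm. apply le_sqrt_of_sq.
  assert (H := pow2_ge_0 (d2 (fst p) (fst q))). lra.
Qed.

Lemma d3_le (p q : pt3) :
  d3 p q <= Rabs (p1 p - p1 q) + d2 (p2 p, p3 p) (p2 q, p3 q).
Proof.
  destruct p as [[x y] z], q as [[x' y'] z']. unfold p1, p2, p3; cbn [fst snd].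
  assert (A := d2_pos (y, z) (y', z')). assert (B := Rabs_pos (x - x')).
  apply sqrt_le_of_sq; [lra|].
  rewrite <- (pow2_abs (x - x')).
  assert (C : d2 (y, z) (y', z') ^ 2 = (y - y') ^ 2 + (z - z') ^ 2).
  { unfold d2. cbn [fst snd]. rewrite pow2_sqrt; auto.
    assert (H := pow2_ge_0 (y - y')). assert (H' := pow2_ge_0 (z - z')). lra. }
  nra.
Qed.

Lemma d3_pos (p q : pt3) : 0 <= d3 p q.
Proof. eapply Rle_trans; [apply d2_pos | apply d3_fst]. Qed.

Lemma d3_refl p : d3 p p = 0.
Proof.
  apply Rle_antisym; [|apply d3_pos]. eapply Rle_trans; [apply d3_le|].
  rewrite Rminus_diag, Rabs_R0, d2_refl. lra.
Qed.

Lemma d3_eq (p q : pt3) : d3 p q <= 0 -> p = q.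
Proof.
  intros H.
  assert (A : fst p = fst q) by (apply d2_eq; eapply Rle_trans; [apply d3_fst | exact H]).
  assert (B : Rabs (p3 p - p3 q) <= 0) by (eapply Rle_trans; [apply d3_p3 | exact H]).
  destruct p as [xy z], q as [xy' z']; unfold p3 in B; simpl in *.
  f_equal; auto. apply Rminus_diag_uniq. destruct (Req_dec (z - z') 0) as [E|E]; auto.
  apply Rabs_pos_lt in E. lra.
Qed.

Section Coordinates.
Context {T : Type} (d : T -> T -> R) (X : T -> Prop).

Lemma cont_pair (f g : T -> R) x : cont_at d dR X f x -> cont_at d dR X g x ->
  cont_at d d2 X (fun y => (f y, g y)) x.
Proof.
  intros Hf Hg eps He.
  destruct (Hf (eps / 2)) as [e1 [He1 H1]]; [lra|].
  destruct (Hg (eps / 2)) as [e2 [He2 H2]]; [lra|].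
  exists (Rmin e1 e2). split. { now apply Rmin_pos. }
  intros y Hy Hxy.
  assert (A := H1 y Hy (Rlt_le_trans _ _ _ Hxy (Rmin_l _ _))).
  assert (B := H2 y Hy (Rlt_le_trans _ _ _ Hxy (Rmin_r _ _))).
  eapply Rle_lt_trans; [apply d2_le | unfold dR in *; simpl; lra].
Qed.

Lemma cont_triple (f g h : T -> R) x :
  cont_at d dR X f x -> cont_at d dR X g x -> cont_at d dR X h x ->
  cont_at d d3 X (fun y => (f y, g y, h y)) x.
Proof.
  intros Hf Hg Hh eps He.
  destruct (Hf (eps / 2)) as [e1 [He1 H1]]; [lra|].
  destruct (cont_pair g h x Hg Hh (eps / 2)) as [e2 [He2 H2]]; [lra|].
  exists (Rmin e1 e2). split. { now apply Rmin_pos. }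
  intros y Hy Hxy.
  assert (A := H1 y Hy (Rlt_le_trans _ _ _ Hxy (Rmin_l _ _))).
  assert (B := H2 y Hy (Rlt_le_trans _ _ _ Hxy (Rmin_r _ _))).
  eapply Rle_lt_trans; [apply d3_le|]. replace eps with (eps / 2 + eps / 2) by lra.
  now apply Rplus_lt_compat.
Qed.

Lemma cont_fst (f : T -> pt2) x : cont_at d d2 X f x ->
  cont_at d dR X (fun y => fst (f y)) x.
Proof.
  intros H eps He. destruct (H eps He) as [e [He' H1]]. exists e. split; auto.
  intros y Hy Hxy. eapply Rle_lt_trans; [apply d2_fst | now apply H1].
Qed.

Lemma cont_snd (f : T -> pt2) x : cont_at d d2 X f x ->
  cont_at d dR X (fun y => snd (f y)) x.
Proof.
  intros H eps He. destruct (H eps He) as [e [He' H1]]. exists e. split; auto.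
  intros y Hy Hxy. eapply Rle_lt_trans; [apply d2_snd | now apply H1].
Qed.

Lemma cont_p1 (f : T -> pt3) x : cont_at d d3 X f x ->
  cont_at d dR X (fun y => p1 (f y)) x.
Proof.
  intros H eps He. destruct (H eps He) as [e [He' H1]]. exists e. split; auto.
  intros y Hy Hxy. eapply Rle_lt_trans; [apply d3_p1 | now apply H1].
Qed.

Lemma cont_p2 (f : T -> pt3) x : cont_at d d3 X f x ->
  cont_at d dR X (fun y => p2 (f y)) x.
Proof.
  intros H eps He. destruct (H eps He) as [e [He' H1]]. exists e. split; auto.
  intros y Hy Hxy. eapply Rle_lt_trans; [apply d3_p2 | now apply H1].
Qed.

Lemma cont_p3 (f : T -> pt3) x : cont_at d d3 X f x ->
  cont_at d dR X (fun y => p3 (f y)) x.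
Proof.
  intros H eps He. destruct (H eps He) as [e [He' H1]]. exists e. split; auto.
  intros y Hy Hxy. eapply Rle_lt_trans; [apply d3_p3 | now apply H1].
Qed.

End Coordinates.

(** The maximum metric matches the form of [homotopic], where one [delta] bounds the changes of time
    and of place separately. *)
Definition dprod {A : Type} (d : A -> A -> R) (a b : R * A) : R :=
  Rmax (dR (fst a) (fst b)) (d (snd a) (snd b)).

Section Product.
Context {A B : Type} (dA : A -> A -> R) (X : R * A -> Prop).

Lemma cont_time a : cont_at (dprod dA) dR X fst a.
Proof.
  intros eps He. exists eps. split; auto. intros y _ H.
  eapply Rle_lt_trans; [apply Rmax_l | exact H].
Qed.

Lemma cont_space a : cont_at (dprod dA) dA X snd a.
Proof.
  intros eps He. exists eps. split; auto. intros y _ H.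
  eapply Rle_lt_trans; [apply Rmax_r | exact H].
Qed.

Lemma cont_dprod {T : Type} (d : T -> T -> R) (Y : T -> Prop) (f : T -> R) (g : T -> A) x :
  cont_at d dR Y f x -> cont_at d dA Y g x ->
  cont_at d (dprod dA) Y (fun y => (f y, g y)) x.
Proof.
  intros Hf Hg eps He.
  destruct (Hf eps He) as [e1 [He1 H1]]. destruct (Hg eps He) as [e2 [He2 H2]].
  exists (Rmin e1 e2). split. { now apply Rmin_pos. }
  intros y Hy Hxy. apply Rmax_lub_lt; simpl.
  - apply H1; auto. eapply Rlt_le_trans; [exact Hxy | apply Rmin_l].
  - apply H2; auto. eapply Rlt_le_trans; [exact Hxy | apply Rmin_r].
Qed.

End Product.

Ltac cont :=
  repeat first
    [ apply cont_time | apply cont_space | apply cont_const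
    | apply cont_triple | apply cont_pair
    | apply cont_plus | apply cont_minus | apply cont_mult | apply cont_opp
    | apply cont_max | apply cont_min | apply cont_abs | apply cont_at_id
    | match goal with
      | |- cont_at _ _ _ (fun _ => p1 _) _ => apply cont_p1
      | |- cont_at _ _ _ (fun _ => p2 _) _ => apply cont_p2
      | |- cont_at _ _ _ (fun _ => p3 _) _ => apply cont_p3
      | |- cont_at _ _ _ p1 _ => apply (cont_p1 _ _ (fun r => r))
      | |- cont_at _ _ _ p2 _ => apply (cont_p2 _ _ (fun r => r))
      | |- cont_at _ _ _ p3 _ => apply (cont_p3 _ _ (fun r => r))
      | |- cont_at _ _ _ fst _ => apply (cont_fst _ _ (fun r => r))
      | |- cont_at _ _ _ snd _ => apply (cont_snd _ _ (fun r => r))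
      | |- cont_at _ _ _ (fun _ => fst _) _ => apply cont_fst
      | |- cont_at _ _ _ (fun _ => snd _) _ => apply cont_snd
      end ].

(** Pasting along two closed pieces. If [x] lies outside one piece, continuity of [phi] keeps a
    neighbourhood of [x] away from it, so each formula need only be continuous on its own piece. *)
Lemma cont_glue {T U : Type} (dT : T -> T -> R) (dU : U -> U -> R) (X : T -> Prop)
  (phi : T -> R) (c : R) (f g h : T -> U) x :
  X x -> cont_at dT dR X phi x ->
  (forall y, X y -> phi y <= c -> f y = g y) ->
  (forall y, X y -> c <= phi y -> f y = h y) ->
  (phi x <= c -> cont_at dT dU (fun y => X y /\ phi y <= c) g x) ->
  (c <= phi x -> cont_at dT dU (fun y => X y /\ c <= phi y) h x) ->
  cont_at dT dU X f x.
Proof.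
  intros Hx Hphi Hg Hh Cg Ch eps He.
  assert (L : exists e, 0 < e /\ forall y, X y -> dT x y < e -> phi y <= c ->
                dU (f x) (f y) < eps).
  { destruct (Rle_dec (phi x) c) as [Hc | Hc].
    - destruct (Cg Hc eps He) as [e [He1 H1]]. exists e. split; auto.
      intros y Hy Hxy Hyc. rewrite !Hg; auto.
    - destruct (Hphi (phi x - c)) as [e [He1 H1]]; [lra|]. exists e. split; auto.
      intros y Hy Hxy Hyc. assert (A := H1 y Hy Hxy). unfold dR in A.
      apply Rabs_def2 in A. lra. }
  assert (G : exists e, 0 < e /\ forall y, X y -> dT x y < e -> c <= phi y ->
                dU (f x) (f y) < eps).
  { destruct (Rle_dec c (phi x)) as [Hc | Hc].
    - destruct (Ch Hc eps He) as [e [He1 H1]]. exists e. split; auto.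
      intros y Hy Hxy Hyc. rewrite !Hh; auto.
    - destruct (Hphi (c - phi x)) as [e [He1 H1]]; [lra|]. exists e. split; auto.
      intros y Hy Hxy Hyc. assert (A := H1 y Hy Hxy). unfold dR in A.
      apply Rabs_def2 in A. lra. }
  destruct L as [e1 [He1 L]], G as [e2 [He2 G]].
  exists (Rmin e1 e2). split. { now apply Rmin_pos. }
  intros y Hy Hxy. destruct (Rle_dec (phi y) c).
  - apply L; auto. eapply Rlt_le_trans; [exact Hxy | apply Rmin_l].
  - apply G; auto; [|lra]. eapply Rlt_le_trans; [exact Hxy | apply Rmin_r].
Qed.

(** * Families of paths *)

Definition unit_interval (t : R) : Prop := 0 <= t <= 1.

Definition cylinder {A : Type} (X : A -> Prop) (a : R * A) : Prop :=
  unit_interval (fst a) /\ X (snd a).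

(** A family of paths [t |-> F t x] in [Y], jointly continuous only at the points [(t, z)]. *)
Definition path_family {A B : Type} (dA : A -> A -> R) (dB : B -> B -> R)
  (X : A -> Prop) (z : A) (Y : B -> Prop) (F : R -> A -> B) : Prop :=
  (forall t x, unit_interval t -> X x -> Y (F t x)) /\
  (forall t x, unit_interval t -> X x -> cont_at dR dB unit_interval (fun s => F s x) t) /\
  (forall t, unit_interval t ->
     cont_at (dprod dA) dB (cylinder X) (fun a => F (fst a) (snd a)) (t, z)).

Definition concat {A B : Type} (F G : R -> A -> B) (t : R) (x : A) : B :=
  if Rle_dec t (1 / 2) then F (2 * t) x else G (2 * t - 1) x.

Lemma concat_0 {A B : Type} (F G : R -> A -> B) x : concat F G 0 x = F 0 x.
Proof. unfold concat. destruct Rle_dec; [f_equal; ring | lra]. Qed.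

Lemma concat_1 {A B : Type} (F G : R -> A -> B) x : concat F G 1 x = G 1 x.
Proof. unfold concat. destruct Rle_dec; [lra | f_equal; ring]. Qed.

Section PathFamilies.
Context {A B : Type} (dA : A -> A -> R) (dB : B -> B -> R).

Lemma path_family_concat (X : A -> Prop) z (Y : B -> Prop) F G :
  X z -> path_family dA dB X z Y F -> path_family dA dB X z Y G ->
  (forall x, X x -> F 1 x = G 0 x) -> path_family dA dB X z Y (concat F G).
Proof.
  intros Hz [F1 [F2 F3]] [G1 [G2 G3]] E.
  assert (Eg : forall t x, X x -> 1 / 2 <= t -> concat F G t x = G (2 * t - 1) x).
  { intros t x Hx Ht. unfold concat. destruct Rle_dec; auto.
    replace t with (1 / 2) by lra. replace (2 * (1 / 2)) with 1 by lra.
    rewrite E; auto. f_equal; lra. }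
  assert (Ef : forall t x, X x -> t <= 1 / 2 -> concat F G t x = F (2 * t) x).
  { intros t x Hx Ht. unfold concat. destruct Rle_dec; auto; lra. }
  unfold path_family, unit_interval in *. split; [|split].
  - intros t x Ht Hx. unfold concat. destruct Rle_dec; [apply F1 | apply G1]; auto; lra.
  - intros t x Ht Hx.
    apply cont_glue with (phi := fun s => s) (c := 1 / 2)
      (g := fun s => F (2 * s) x) (h := fun s => G (2 * s - 1) x); auto.
    + apply cont_at_id.
    + intros. apply (cont_at_comp dR dR dB _ unit_interval (fun s => 2 * s) (fun s => F s x)).
      * cont.
      * unfold unit_interval; intros; lra.
      * apply F2; auto; lra.
    + intros.
      apply (cont_at_comp dR dR dB _ unit_interval (fun s => 2 * s - 1) (fun s => G s x)).
      * cont.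
      * unfold unit_interval; intros; lra.
      * apply G2; auto; lra.
  - intros t Ht.
    apply cont_glue with (phi := fst) (c := 1 / 2)
      (g := fun a => F (2 * fst a) (snd a)) (h := fun a => G (2 * fst a - 1) (snd a)).
    + split; auto.
    + apply cont_time.
    + intros y [_ Hy] H. now apply Ef.
    + intros y [_ Hy] H. now apply Eg.
    + intros. apply (cont_at_comp (dprod dA) (dprod dA) dB _ (cylinder X)
        (fun a => (2 * fst a, snd a)) (fun a => F (fst a) (snd a))).
      * apply cont_dprod; cont.
      * unfold cylinder, unit_interval; simpl; intros; lra || (split; [lra | tauto]).
      * apply F3; simpl in *; lra.
    + intros. apply (cont_at_comp (dprod dA) (dprod dA) dB _ (cylinder X)
        (fun a => (2 * fst a - 1, snd a)) (fun a => G (fst a) (snd a))).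
      * apply cont_dprod; cont.
      * unfold cylinder, unit_interval; simpl; intros; split; [lra | tauto].
      * apply G3; simpl in *; lra.
Qed.

Lemma path_family_post {C : Type} (dC : C -> C -> R)
  (X : A -> Prop) z (Y : B -> Prop) (W : C -> Prop) F h :
  X z -> path_family dA dB X z Y F -> (forall y, Y y -> W (h y)) -> cont_on dB dC Y h ->
  path_family dA dC X z W (fun t x => h (F t x)).
Proof.
  intros Hz [F1 [F2 F3]] HW Hh. split; [|split].
  - auto.
  - intros t x Ht Hx. apply (cont_at_comp dR dB dC _ Y (fun s => F s x) h); auto.
    intros e He. apply Hh; auto.
  - intros t Ht. apply (cont_at_comp (dprod dA) dB dC _ Y (fun a => F (fst a) (snd a)) h); auto.
    + intros y [Hy1 Hy2]. auto.
    + intros e He. apply Hh; simpl; auto.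
Qed.

Lemma path_family_pre {C : Type} (dC : C -> C -> R)
  (X : A -> Prop) z (Y : B -> Prop) (X' : C -> Prop) z' F f :
  path_family dA dB X z Y F -> f z' = z -> (forall x, X' x -> X (f x)) ->
  cont_at dC dA X' f z' ->
  path_family dC dB X' z' Y (fun t x => F t (f x)).
Proof.
  intros [F1 [F2 F3]] Ez HX Hf. split; [|split]; auto.
  intros t Ht.
  apply (cont_at_comp (dprod dC) (dprod dA) dB _ (cylinder X)
           (fun a => (fst a, f (snd a))) (fun a => F (fst a) (snd a))).
  - apply cont_dprod; [apply cont_time|].
    apply (cont_at_comp (dprod dC) dC dA _ X' snd f); [apply cont_space | | exact Hf].
    intros y [_ Hy]; auto.
  - intros y [Hy1 Hy2]; split; simpl; auto.
  - simpl. rewrite Ez. auto.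
Qed.

Lemma path_family_subset (X X' : A -> Prop) z (Y : B -> Prop) F :
  path_family dA dB X z Y F -> (forall x, X' x -> X x) -> path_family dA dB X' z Y F.
Proof.
  intros [F1 [F2 F3]] HX. split; [|split]; auto.
  intros t Ht. eapply cont_at_subset; [apply F3; auto|].
  intros y [Hy1 Hy2]; split; auto.
Qed.

End PathFamilies.

Lemma path_family_of_joint {A B : Type} (dA : A -> A -> R) (dB : B -> B -> R)
  (X : A -> Prop) z (Y : B -> Prop) F :
  X z -> (forall x, dA x x = 0) ->
  (forall t x, unit_interval t -> X x -> Y (F t x)) ->
  (forall t x, unit_interval t -> X x ->
     cont_at (dprod dA) dB (cylinder X) (fun a => F (fst a) (snd a)) (t, x)) ->
  path_family dA dB X z Y F.
Proof.
  intros Hz Hr HY HF. split; [|split]; auto.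
  intros t x Ht Hx eps He. destruct (HF t x Ht Hx eps He) as [e [He1 H1]].
  exists e. split; auto. intros s Hs Hts. apply (H1 (s, x)).
  - split; auto.
  - apply Rmax_lub_lt; simpl; auto. now rewrite Hr.
Qed.

Lemma homotopic_cont_at (X Y : pt3 -> Prop) (K : R -> pt3 -> pt3) :
  (forall t x, 0 <= t <= 1 -> X x -> forall eps, 0 < eps ->
       exists delta, 0 < delta /\
         forall t' y, 0 <= t' <= 1 -> X y -> Rabs (t - t') < delta ->
           d3 x y < delta -> d3 (K t x) (K t' y) < eps) ->
  forall t x, unit_interval t -> X x ->
     cont_at (dprod d3) d3 (cylinder X) (fun a => K (fst a) (snd a)) (t, x).
Proof.
  intros H t x Ht Hx eps He. destruct (H t x Ht Hx eps He) as [e [He1 H1]].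
  exists e. split; auto. intros [s y] [Hs Hy] Hd. simpl in *. apply H1; auto.
  - eapply Rle_lt_trans; [apply Rmax_l | exact Hd].
  - eapply Rle_lt_trans; [apply Rmax_r | exact Hd].
Qed.

(** * Real induction and the reciprocals of integers *)

(** Let [s] be the supremum of the initial segments on which [Q] holds. The hypothesis at [s]
    extends [Q] past [s], which forces [s = T] and covers [T] itself. *)
Lemma real_induction (T : R) (Q : R -> Prop) :
  (forall s, 0 <= s <= T -> (forall t, 0 <= t < s -> Q t) ->
     exists e, 0 < e /\ forall t, 0 <= t <= T -> Rabs (t - s) < e -> Q t) ->
  forall t, 0 <= t <= T -> Q t.
Proof.
  intros H t0 Ht0.
  pose (E := fun s => 0 <= s <= T /\ forall t, 0 <= t < s -> Q t).
  destruct (completeness E) as [s [Hub Hlub]].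
  { exists T. intros s [Hs _]. lra. }
  { exists 0. split; [lra|]. intros; lra. }
  assert (Hs : 0 <= s <= T).
  { split.
    - apply Hub. split; [lra|]. intros; lra.
    - apply Hlub. intros r [Hr _]. lra. }
  assert (HQ : forall t, 0 <= t < s -> Q t).
  { intros t Ht. destruct (classic (exists r, E r /\ t < r)) as [[r [[Hr Hr'] Htr]] | N].
    - apply Hr'. lra.
    - assert (s <= t); [|lra]. apply Hlub. intros r Hr.
      destruct (Rle_dec r t); auto. exfalso. apply N. exists r. split; auto. lra. }
  destruct (H s Hs HQ) as [e [He H1]].
  destruct (Rlt_dec t0 s) as [L | L]. { apply HQ; lra. }
  apply H1; [lra|].
  assert (Hm : Rmin T (s + e / 2) <= s).
  { apply Hub. split.
    - split; [apply Rmin_glb; lra | apply Rmin_l].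
    - intros t Ht. assert (t < T /\ t < s + e / 2) as [A1 A2].
      { split; (eapply Rlt_le_trans; [apply Ht|]); [apply Rmin_l | apply Rmin_r]. }
      destruct (Rlt_dec t s); [apply HQ; lra|].
      apply H1; [lra|]. rewrite Rabs_pos_eq; lra. }
  unfold Rmin in Hm. destruct Rle_dec in Hm; [|lra].
  rewrite Rabs_pos_eq; lra.
Qed.

Lemma finite_min (P : nat -> R -> Prop) (N : nat) :
  (forall i a b, P i a -> 0 < b <= a -> P i b) ->
  (forall i, (i < N)%nat -> exists e, 0 < e /\ P i e) ->
  exists e, 0 < e /\ forall i, (i < N)%nat -> P i e.
Proof.
  intros Hmon. induction N as [|N IH]; intros H.
  - exists 1. split; [lra|]. intros; lia.
  - destruct IH as [e [He H1]]. { intros; apply H; lia. }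
    destruct (H N) as [e' [He' H2]]; [lia|].
    assert (Hp : 0 < Rmin e e') by now apply Rmin_pos.
    exists (Rmin e e'). split; auto. intros i Hi.
    destruct (Nat.eq_dec i N) as [-> | Hn].
    + apply Hmon with e'; auto. split; auto. apply Rmin_r.
    + apply Hmon with e; [apply H1; lia|]. split; auto. apply Rmin_l.
Qed.

Lemma INR_S_pos (k : nat) : 0 < INR (S k).
Proof. apply lt_0_INR. lia. Qed.

Lemma inv_INR_pos (k : nat) : 0 < / INR (S k).
Proof. apply Rinv_0_lt_compat, INR_S_pos. Qed.

Lemma inv_INR_le_1 (k : nat) : / INR (S k) <= 1.
Proof.
  rewrite <- Rinv_1. apply Rinv_le_contravar; [lra|].
  rewrite S_INR. assert (H := pos_INR k). lra.
Qed.

Lemma inv_INR_small (eps : R) : 0 < eps ->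
  exists N, forall k, (N <= k)%nat -> / INR (S k) < eps.
Proof.
  intros He. destruct (archimed_cor1 eps He) as [N [HN HN0]]. exists N. intros k Hk.
  eapply Rle_lt_trans; [|exact HN]. apply Rinv_le_contravar.
  - now apply lt_0_INR.
  - apply le_INR. lia.
Qed.

Lemma inv_INR_inj (k l : nat) : / INR (S k) = / INR (S l) -> k = l.
Proof. intros H. apply Rinv_eq_reg in H. apply INR_eq in H. lia. Qed.

(** For positive [c], all but finitely many reciprocals are below [c / 2]; the others that differ
    from [c] leave a least positive distance to it. *)
Lemma inv_INR_isolated (c : R) : c <> 0 ->
  exists e, 0 < e /\ forall k, Rabs (/ INR (S k) - c) < e -> / INR (S k) = c.
Proof.
  intros Hc. destruct (Rlt_dec c 0) as [Hneg | Hpos].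
  - exists (- c). split; [lra|]. intros k Hk. apply Rabs_def2 in Hk.
    assert (H := inv_INR_pos k). lra.
  - destruct (inv_INR_small (c / 2)) as [N HN]; [lra|].
    destruct (finite_min
      (fun k e => Rabs (/ INR (S k) - c) < e -> / INR (S k) = c) N) as [e [He H1]].
    + intros i a b Ha Hb H. apply Ha. lra.
    + intros i _. destruct (Req_dec (/ INR (S i)) c) as [E | E].
      * exists 1. split; [lra | auto].
      * exists (Rabs (/ INR (S i) - c)). split; [apply Rabs_pos_lt; lra | lra].
    + exists (Rmin e (c / 2)). split; [apply Rmin_pos; lra|].
      intros k Hk. destruct (Nat.lt_ge_cases k N) as [L | L].
      * apply H1; auto. eapply Rlt_le_trans; [exact Hk | apply Rmin_l].
      * specialize (HN k L).
        assert (A := Rlt_le_trans _ _ _ Hk (Rmin_r _ _)). apply Rabs_def2 in A. lra.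
Qed.

(** * The broom *)

(** The value 0 stands for the central segment, treated as one more hair. It makes the set of slopes
    closed, on which the compactness of a cone relies. *)
Definition slope (u : R) : Prop := u = 0 \/ exists k, u = / INR (S k).

Lemma slope_bounds u : slope u -> 0 <= u <= 1.
Proof.
  intros [-> | [k ->]]; [lra|]. assert (A := inv_INR_pos k). assert (B := inv_INR_le_1 k). lra.
Qed.

(** [sg = 1] and [sg = -1] are the upper and the lower cone; [s] is the height along a hair. *)
Lemma broom_iff (p : pt2) : broom p <->
  exists sg u s, (sg = 1 \/ sg = -1) /\ slope u /\ 0 <= s <= 1 /\
    p = (sg * (u * (1 - s)), sg * s).
Proof.
  split.
  - intros [[t [Ht ->]] | [[t [Ht ->]] | [[k [t [Ht ->]]] | [k [t [Ht ->]]]]]]; cbn [fst snd].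
    + exists 1, 0, t. repeat split; auto; try lra; [now left | f_equal; ring].
    + exists (-1), 0, t. repeat split; auto; try lra; [now left | f_equal; ring].
    + exists 1, (/ INR (S k)), t. repeat split; auto; try lra; [right; now exists k | f_equal; ring].
    + exists (-1), (/ INR (S k)), t. repeat split; auto; try lra; [right; now exists k | f_equal; ring].
  - intros [sg [u [s [[-> | ->] [[-> | [k ->]] [Hs ->]]]]]]; unfold broom, seg2; cbn [fst snd].
    + left. exists s. split; auto. f_equal; ring.
    + right; right; left. exists k, s. split; auto. f_equal; ring.
    + right; left. exists s. split; auto. f_equal; ring.
    + right; right; right. exists k, s. split; auto. f_equal; ring.
Qed.

Lemma broom_center : broom (0, 0).
Proof. left. exists 0. split; [lra|]. simpl. f_equal; ring. Qed.

Lemma broom_hair_end (sg : R) (k : nat) : sg = 1 \/ sg = -1 ->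
  broom (sg * / INR (S k), 0).
Proof.
  intros Hs. apply broom_iff. exists sg, (/ INR (S k)), 0.
  repeat split; auto; try lra; [right; now exists k | f_equal; ring].
Qed.

(** On the part [|y| < 1] of the broom this is the signed slope of the hair through [q]. *)
Definition ratio (q : pt2) : R := fst q * / (1 - Rabs (snd q)).

Lemma broom_ratio q : broom q -> Rabs (snd q) < 1 ->
  exists sg u, (sg = 1 \/ sg = -1) /\ slope u /\ ratio q = sg * u /\ 0 <= sg * snd q.
Proof.
  intros H Hq. apply broom_iff in H. destruct H as [sg [u [s [Hsg [Hu [Hs ->]]]]]].
  exists sg, u. unfold ratio. cbn [fst snd] in *.
  assert (E : Rabs (sg * s) = s).
  { destruct Hsg as [-> | ->]; unfold Rabs; destruct Rcase_abs; lra. }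
  rewrite E in *. repeat split; auto.
  - field. lra.
  - destruct Hsg as [-> | ->]; lra.
Qed.

Lemma signed_slope_isolated (c : R) : c <> 0 ->
  exists e, 0 < e /\ forall sg u, (sg = 1 \/ sg = -1) -> slope u ->
    Rabs (sg * u - c) < e -> sg * u = c.
Proof.
  intros Hc. assert (Hc' := Rabs_pos_lt c Hc).
  destruct (inv_INR_isolated (Rabs c)) as [e [He H1]]; [lra|].
  exists (Rmin e (Rabs c)). split; [now apply Rmin_pos|].
  intros sg u Hsg Hu Hd.
  assert (D1 := Rlt_le_trans _ _ _ Hd (Rmin_l _ _)).
  assert (D2 := Rlt_le_trans _ _ _ Hd (Rmin_r _ _)). clear Hd.
  assert (B := slope_bounds u Hu).
  destruct Hu as [-> | [k ->]].
  { exfalso. revert D2. unfold Rabs; repeat destruct Rcase_abs; lra. }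
  assert (E : Rabs (/ INR (S k) - Rabs c) < e -> / INR (S k) = Rabs c) by auto.
  destruct Hsg as [-> | ->]; revert D1 D2 E; unfold Rabs; repeat destruct Rcase_abs; lra.
Qed.

(** [ratio] is continuous along the path and takes values in a set in which [c] is isolated, so
    connectedness of the time interval keeps it at [c]. The bound 1/2 on the height keeps the
    denominator of [ratio] away from zero. *)
Lemma hair_path (T c : R) (g : R -> pt2) : 0 <= T -> c <> 0 ->
  (forall t, 0 <= t <= T -> broom (g t) /\ Rabs (snd (g t)) < 1 / 2) ->
  (forall t, 0 <= t <= T -> cont_at dR d2 (fun s => 0 <= s <= T) g t) ->
  ratio (g 0) = c -> forall t, 0 <= t <= T -> ratio (g t) = c.
Proof.
  intros HT Hc Hg Cg H0. destruct (signed_slope_isolated c Hc) as [e [He Hiso]].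
  assert (Hnear : forall t, 0 <= t <= T -> Rabs (ratio (g t) - c) < e -> ratio (g t) = c).
  { intros t Ht Hd. destruct (Hg t Ht) as [A B].
    destruct (broom_ratio (g t) A) as [sg [u [Hsg [Hu [E _]]]]]; [lra|].
    rewrite E in *. now apply Hiso. }
  apply real_induction. intros s Hs HQ.
  assert (Cr : cont_at dR dR (fun t => 0 <= t <= T) (fun t => ratio (g t)) s).
  { unfold ratio. apply cont_mult; [now apply cont_fst, Cg|].
    apply cont_inv; [destruct (Hg s Hs); lra|].
    apply cont_minus; [apply cont_const | now apply cont_abs, cont_snd, Cg]. }
  destruct (Cr e He) as [d [Hd H1]].
  assert (Es : ratio (g s) = c).
  { destruct (Req_dec s 0) as [-> | Hs0]; auto.
    apply Hnear; auto.
    (* The value at [s] is compared with that at a slightly earlier time, where it is already known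
       to be [c]. *)
    assert (Hm : 0 <= Rmax 0 (s - d / 2) < s).
    { split; [apply Rmax_l | apply Rmax_lub_lt; lra]. }
    rewrite <- (HQ _ Hm). apply H1; [lra|].
    unfold dR. assert (M := Rmax_r 0 (s - d / 2)). rewrite Rabs_pos_eq; lra. }
  exists d. split; auto. intros t Ht Hts. apply Hnear; auto.
  rewrite <- Es, Rabs_minus_sym. apply H1; auto. unfold dR. now rewrite Rabs_minus_sym.
Qed.

Definition hair_end (sg : R) (k : nat) : pt2 := (sg * / INR (S k), 0).

Lemma hair_end_dist sg k : (sg = 1 \/ sg = -1) -> d2 (0, 0) (hair_end sg k) <= / INR (S k).
Proof.
  intros Hs. eapply Rle_trans; [apply d2_le|]. unfold hair_end. cbn [fst snd].
  assert (A := inv_INR_pos k).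
  rewrite Rminus_diag, Rabs_R0.
  destruct Hs as [-> | ->]; unfold Rabs; destruct Rcase_abs; lra.
Qed.

Lemma ratio_hair_end sg k : ratio (hair_end sg k) = sg * / INR (S k).
Proof. unfold ratio, hair_end. cbn [fst snd]. rewrite Rabs_R0. field. apply not_0_INR. lia. Qed.

(** While the image of the centre is near the centre, the hair ends on both sides cannot
    leave their hairs; in the limit the centre stays both in the upper and in the lower cone. *)
Lemma broom_rigid (r : R) (Phi : R -> pt2 -> pt2) : 0 < r ->
  path_family d2 d2 (fun p => broom p /\ d2 (0, 0) p < r) (0, 0) broom Phi ->
  (forall p, broom p -> d2 (0, 0) p < r -> Phi 0 p = p) ->
  exists N, forall sg k t, (sg = 1 \/ sg = -1) -> (N <= k)%nat -> 0 <= t <= 1 ->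
    Rabs (snd (Phi t (hair_end sg k))) < 1 / 2 /\
    ratio (Phi t (hair_end sg k)) = sg * / INR (S k).
Proof.
  intros Hr [F1 [F2 F3]] F0.
  assert (Hc : broom (0, 0) /\ d2 (0, 0) (0, 0) < r).
  { split; [apply broom_center | now rewrite d2_refl]. }
  (* The threshold [N] may grow with [s], but serves all times up to [s] at once; this is what real
     induction propagates. *)
  pose (Q := fun s => exists N, forall sg k t,
    (sg = 1 \/ sg = -1) -> (N <= k)%nat -> 0 <= t <= s ->
    Rabs (snd (Phi t (hair_end sg k))) < 1 / 2 /\
    ratio (Phi t (hair_end sg k)) = sg * / INR (S k)).
  assert (HQ : forall t, 0 <= t <= 1 -> Q t).
  2: { exact (HQ 1 ltac:(lra)). }
  apply real_induction. intros s Hs IH.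
  (* With 1/8 the image of the centre at time [s] has height at most 1/8, so hair ends stay below
     height 1/4 at nearby times, well under the required 1/2. *)
  destruct (F3 s Hs (1 / 8)) as [d [Hd J]]; [lra|]. cbn [fst snd] in J.
  destruct (inv_INR_small (Rmin r d)) as [N1 HN1]; [now apply Rmin_pos|].
  assert (HX : forall sg k, (sg = 1 \/ sg = -1) -> (N1 <= k)%nat ->
            (broom (hair_end sg k) /\ d2 (0, 0) (hair_end sg k) < r) /\
            d2 (0, 0) (hair_end sg k) < d).
  { intros sg k Hsg Hk. specialize (HN1 k Hk). assert (A := hair_end_dist sg k Hsg).
    assert (B := Rmin_l r d). assert (C := Rmin_r r d).
    split; [split; [now apply broom_hair_end | lra] | lra]. }
  assert (HJ : forall sg k t, (sg = 1 \/ sg = -1) -> (N1 <= k)%nat -> 0 <= t <= 1 ->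
            Rabs (t - s) < d -> d2 (Phi s (0, 0)) (Phi t (hair_end sg k)) < 1 / 8).
  { intros sg k t Hsg Hk Ht Hts. destruct (HX sg k Hsg Hk) as [A B].
    apply (J (t, hair_end sg k)).
    - split; auto.
    - apply Rmax_lub_lt; cbn [fst snd]; auto. unfold dR. now rewrite Rabs_minus_sym. }
  assert (HN2 : exists N2,
    (forall sg k t, (sg = 1 \/ sg = -1) -> (N2 <= k)%nat -> 0 <= t <= 1 ->
       t <= s - d / 2 -> Rabs (snd (Phi t (hair_end sg k))) < 1 / 2) /\
    Rabs (snd (Phi s (0, 0))) <= 1 / 8).
  { destruct (Req_dec s 0) as [-> | Hs0].
    - exists 0%nat. split; [intros; lra|]. rewrite F0; try apply Hc.
      cbn [snd]. rewrite Rabs_R0. lra.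
    - assert (Hm : 0 <= Rmax 0 (s - d / 2) < s).
      { split; [apply Rmax_l | apply Rmax_lub_lt; lra]. }
      destruct (IH _ Hm) as [N2 HN2]. exists N2. split.
      + intros sg k t Hsg Hk Ht Hts. apply HN2; auto. split; [lra|].
        eapply Rle_trans; [exact Hts | apply Rmax_r].
      (* Just before [s], an end of sign [sg] is still on its hair, so [sg] times its height is
         nonnegative. The image of the centre at [s] is within 1/8 of it; the two signs bound its
         height from both sides. *)
      + assert (P : forall sg, (sg = 1 \/ sg = -1) -> - (1 / 8) <= sg * snd (Phi s (0, 0))).
        { intros sg Hsg. pose (k := Nat.max N1 N2).
          assert (K1 : (N1 <= k)%nat) by (unfold k; lia).
          assert (K2 : (N2 <= k)%nat) by (unfold k; lia).
          destruct (HN2 sg k _ Hsg K2 (conj (proj1 Hm) (Rle_refl _))) as [A B].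
          assert (D : d2 (Phi s (0, 0)) (Phi (Rmax 0 (s - d / 2)) (hair_end sg k)) < 1 / 8).
          { apply HJ; auto; [lra|]. assert (M := Rmax_r 0 (s - d / 2)).
            rewrite Rabs_minus_sym, Rabs_pos_eq; lra. }
          assert (Bq : broom (Phi (Rmax 0 (s - d / 2)) (hair_end sg k))).
          { apply F1; [unfold unit_interval; lra | now apply HX]. }
          set (q := Phi (Rmax 0 (s - d / 2)) (hair_end sg k)) in *.
          destruct (broom_ratio q Bq) as [sg' [u [Hsg' [Hu [E Hpos]]]]]; [lra|].
          assert (sg' = sg).
          { rewrite B in E. assert (A1 := inv_INR_pos k). apply slope_bounds in Hu.
            destruct Hsg as [-> | ->], Hsg' as [-> | ->]; auto; lra. }
          subst sg'. assert (D' := Rle_lt_trans _ _ _ (d2_snd _ _) D).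
          apply Rabs_def2 in D'. destruct Hsg as [-> | ->]; lra. }
        assert (P1 := P 1 ltac:(auto)). assert (P2 := P (-1) ltac:(auto)).
        apply Rabs_le. lra. }
  destruct HN2 as [N2 [HN2 Hsv]].
  exists d. split; auto. intros t Ht Hts.
  exists (Nat.max N1 N2). intros sg k.
  assert (Hall : forall t', (sg = 1 \/ sg = -1) -> (Nat.max N1 N2 <= k)%nat -> 0 <= t' <= t ->
     Rabs (snd (Phi t' (hair_end sg k))) < 1 / 2).
  (* Times up to [s - d / 2] come from the induction hypothesis, later ones from continuity at time
     [s] and the centre. *)
  { intros t' Hsg Hk Ht'. destruct (Rle_dec t' (s - d / 2)) as [L | L].
    - apply HN2; auto; [lia | lra].
    - assert (D : d2 (Phi s (0, 0)) (Phi t' (hair_end sg k)) < 1 / 8).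
      { apply HJ; auto; [lia | lra|]. apply Rabs_def2 in Hts. apply Rabs_def1; lra. }
      assert (D' := Rle_lt_trans _ _ _ (d2_snd _ _) D).
      revert D' Hsv. unfold Rabs; repeat destruct Rcase_abs; lra. }
  intros t' Hsg Hk Ht'. split; [now apply Hall|].
  assert (Hk1 : (N1 <= k)%nat) by lia.
  apply (hair_path t (sg * / INR (S k)) (fun t => Phi t (hair_end sg k))); auto; try lra.
  - assert (A1 := inv_INR_pos k). destruct Hsg as [-> | ->]; lra.
  - intros t0 Ht0. split; [|now apply Hall].
    apply F1; [unfold unit_interval; lra | now apply HX].
  - intros t0 Ht0. apply cont_at_subset with (X := unit_interval).
    + apply F2; [unfold unit_interval; lra | now apply HX].
    + unfold unit_interval; intros; lra.
  - rewrite F0; try now apply HX. apply ratio_hair_end.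
Qed.

Lemma cont_at_unique {T : Type} (dT : T -> T -> R) (X : T -> Prop)
  (f : T -> pt3) (x : T) (y : pt3) :
  cont_at dT d3 X f x ->
  (forall d eps, 0 < d -> 0 < eps -> exists z, X z /\ dT x z < d /\ d3 y (f z) < eps) ->
  f x = y.
Proof.
  intros Cf H. apply d3_eq. apply Rnot_lt_le. intros Hlt.
  destruct (Cf (d3 (f x) y / 2)) as [e [He H1]]; [lra|].
  destruct (H e (d3 (f x) y / 2)) as [z [Hz [H2 H3]]]; auto; [lra|].
  specialize (H1 z Hz H2). assert (A := d3_triangle (f x) (f z) y).
  rewrite (d3_sym (f z) y) in A. lra.
Qed.

Lemma broom_rigid_center (r : R) (Phi : R -> pt2 -> pt2) : 0 < r ->
  path_family d2 d2 (fun p => broom p /\ d2 (0, 0) p < r) (0, 0) broom Phi ->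
  (forall p, broom p -> d2 (0, 0) p < r -> Phi 0 p = p) ->
  forall t, 0 <= t <= 1 -> Phi t (0, 0) = (0, 0).
Proof.
  intros Hr HF F0 t Ht. destruct (broom_rigid r Phi Hr HF F0) as [N HN].
  destruct HF as [F1 [F2 F3]]. apply d2_eq. apply Rnot_lt_le. intros Hlt.
  (* The bounds below are [2 * e] for the abscissa of [w] and [e] for its height; their sum is less
     than the distance [4 * e]. *)
  set (w := Phi t (0, 0)) in *. set (e := d2 w (0, 0) / 4).
  assert (He : 0 < e) by (unfold e; lra).
  destruct (F3 t Ht e He) as [d [Hd J]]. cbn [fst snd] in J. fold w in J.
  destruct (inv_INR_small (Rmin (Rmin r d) e)) as [N1 HN1].
  { repeat apply Rmin_pos; auto. }
  pose (k := Nat.max N N1). assert (Kn : (N1 <= k)%nat) by (unfold k; lia).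
  specialize (HN1 k Kn).
  assert (HN1' := Rlt_le_trans _ _ _ HN1 (Rmin_l _ _)).
  assert (L1 := Rlt_le_trans _ _ _ HN1' (Rmin_l _ _)).
  assert (L2 := Rlt_le_trans _ _ _ HN1' (Rmin_r _ _)).
  assert (L3 := Rlt_le_trans _ _ _ HN1 (Rmin_r _ _)).
  assert (P : forall sg, (sg = 1 \/ sg = -1) -> Rabs (fst w) < 2 * e /\ - e < sg * snd w).
  { intros sg Hsg. destruct (HN sg k t Hsg) as [A B]; auto; [unfold k; lia|].
    assert (Hx : broom (hair_end sg k) /\ d2 (0, 0) (hair_end sg k) < r).
    { split; [now apply broom_hair_end|]. assert (Z := hair_end_dist sg k Hsg). lra. }
    assert (D : d2 w (Phi t (hair_end sg k)) < e).
    { apply (J (t, hair_end sg k)); [split; auto|].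
      apply Rmax_lub_lt; cbn [fst snd].
      - unfold dR. rewrite Rminus_diag, Rabs_R0; auto.
      - assert (Z := hair_end_dist sg k Hsg). lra. }
    assert (Bq : broom (Phi t (hair_end sg k))) by (apply F1; auto).
    set (q := Phi t (hair_end sg k)) in *.
    destruct (broom_ratio q Bq) as [sg' [u [Hsg' [Hu [E Hpos]]]]]; [lra|].
    assert (A1 := inv_INR_pos k).
    assert (sg' = sg).
    { rewrite B in E. apply slope_bounds in Hu.
      destruct Hsg as [-> | ->], Hsg' as [-> | ->]; auto; lra. }
    subst sg'.
    assert (D1 := Rle_lt_trans _ _ _ (d2_fst _ _) D).
    assert (D2 := Rle_lt_trans _ _ _ (d2_snd _ _) D).
    assert (Eq : fst q = sg * / INR (S k) * (1 - Rabs (snd q))).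
    { rewrite <- B. unfold ratio. field. lra. }
    assert (Hf : Rabs (fst q) < e).
    { rewrite Eq. assert (Z := Rabs_pos (snd q)).
      destruct Hsg as [-> | ->]; apply Rabs_def1; nra. }
    split.
    - revert D1 Hf. unfold Rabs; repeat destruct Rcase_abs; lra.
    - apply Rabs_def2 in D2. destruct Hsg as [-> | ->]; lra. }
  destruct (P 1 ltac:(auto)) as [P1 P2]. destruct (P (-1) ltac:(auto)) as [_ P3].
  assert (A := d2_le w (0, 0)). cbn [fst snd] in A. rewrite !Rminus_0_r in A.
  assert (Rabs (snd w) < e) by (apply Rabs_def1; lra).
  unfold e in *. lra.
Qed.

(** * Broom centres under homotopies *)

(** [E] embeds the broom in [Y], and [rho] retracts [Y] to it, sending all the rest of [Y]
    to the centre. *)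
Definition bristle {T : Type} (d : T -> T -> R) (Y : T -> Prop) (E : pt2 -> T)
  (rho : T -> pt2) : Prop :=
  (forall p, broom p -> Y (E p)) /\ cont_on d2 d broom E /\
  (forall y, Y y -> broom (rho y)) /\ cont_on d d2 Y rho /\
  (forall p, broom p -> rho (E p) = p) /\
  (forall y, Y y -> rho y <> (0, 0) -> y = E (rho y)).

(** Paths contracting a neighbourhood of [z] in [Y], with continuity in the starting
    point required only at [z]. *)
Definition locally_pushable (Y : pt3 -> Prop) (z : pt3) : Prop :=
  exists r G, 0 < r /\
    path_family d3 d3 (fun y => Y y /\ d3 z y < r) z Y G /\
    (forall y, Y y -> d3 z y < r -> G 0 y = y /\ G 1 y = G 1 z).

Lemma path_family_homotopy_at_bristle (X : pt3 -> Prop) E rho (K : R -> pt3 -> pt3) :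
  bristle d3 X E rho ->
  (forall t x, unit_interval t -> X x -> X (K t x)) ->
  (forall t x, unit_interval t -> X x ->
     cont_at (dprod d3) d3 (cylinder X) (fun a => K (fst a) (snd a)) (t, x)) ->
  path_family d2 d2 broom (0, 0) broom (fun t p => rho (K t (E p))).
Proof.
  intros [E1 [E2 [R1 [R2 [ER RE]]]]] K1 K2.
  assert (PF : path_family d3 d2 X (E (0, 0)) broom (fun t x => rho (K t x))).
  { apply (path_family_post d3 d3 d2 X _ X broom K rho); auto.
    - apply E1, broom_center.
    - apply path_family_of_joint; auto. apply E1, broom_center. apply d3_refl. }
  apply (path_family_pre d3 d2 d2 X (E (0, 0)) broom broom (0, 0) _ E PF); auto.
  intros e He. apply E2; auto. apply broom_center.
Qed.

Lemma homotopic_reverse (X Y : pt3 -> Prop) (f g : pt3 -> pt3) :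
  homotopic X Y f g -> homotopic X Y g f.
Proof.
  intros [K [K1 [K2 K3]]]. exists (fun t => K (1 - t)). split; [|split].
  - intros; apply K1; auto; lra.
  - intros t x Ht Hx eps He. destruct (K2 (1 - t) x) with (eps := eps) as [e [He1 H1]]; auto; [lra|].
    exists e. split; auto. intros t' y Ht' Hy Htt Hxy. apply H1; auto; [lra|].
    replace (1 - t - (1 - t')) with (- (t - t')) by ring. now rewrite Rabs_Ropp.
  - intros x Hx. rewrite Rminus_0_r, Rminus_diag. destruct (K3 x Hx); auto.
Qed.

Lemma ratio_center : ratio (0, 0) = 0.
Proof. unfold ratio. cbn [fst snd]. ring. Qed.

(** Rigidity in the model only says that [rho] sends the final image to the centre, and [rho] does
    so with everything outside the broom. The images of hair ends, however, have nonzero ratio, so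
    they lie on the broom itself and are recovered from [rho]; they converge to [E (0, 0)], which
    determines the image of the centre. *)
Lemma homotopic_id_fixes_center (X : pt3 -> Prop) E rho h :
  bristle d3 X E rho -> homotopic X X h (fun x => x) -> h (E (0, 0)) = E (0, 0).
Proof.
  intros HB Hh. apply homotopic_reverse in Hh. destruct Hh as [K [K1 [K2 K3]]].
  assert (K2' := homotopic_cont_at X X K K2).
  assert (PF := path_family_homotopy_at_bristle X E rho K HB K1 K2').
  destruct HB as [E1 [E2 [R1 [R2 [ER RE]]]]].
  assert (P0 : forall p, broom p -> d2 (0, 0) p < 1 -> rho (K 0 (E p)) = p).
  { intros p Hp _. destruct (K3 (E p)) as [-> _]; auto. }
  assert (PF' : path_family d2 d2 (fun p => broom p /\ d2 (0, 0) p < 1) (0, 0) broom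
                  (fun t p => rho (K t (E p)))).
  { eapply path_family_subset; [exact PF|]. intros x [Hx _]; exact Hx. }
  assert (Hfix := broom_rigid_center 1 _ Rlt_0_1 PF' P0 1 ltac:(lra)). cbn beta in Hfix.
  destruct (broom_rigid 1 _ Rlt_0_1 PF' P0) as [N HN].
  assert (Bc := broom_center). assert (I1 : unit_interval 1) by (unfold unit_interval; lra).
  destruct (K3 (E (0, 0))) as [_ <-]; auto.
  apply (cont_at_unique d2 broom (fun p => K 1 (E p)) (0, 0)).
  - apply (cont_at_comp d2 (dprod d3) d3 broom (cylinder X)
      (fun p => (1, E p)) (fun a => K (fst a) (snd a))).
    + apply cont_dprod; [apply cont_const | intros e He; apply E2; auto].
    + intros p Hp; split; cbn [fst snd]; auto.
    + apply K2'; auto.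
  - intros d eps Hd He.
    destruct (E2 (0, 0) Bc eps He) as [a [Ha Ea]].
    destruct PF as [_ [_ F3]]. destruct (F3 1 I1 a Ha) as [b [Hb Eb]].
    cbn [fst snd] in Eb. rewrite Hfix in Eb.
    destruct (inv_INR_small (Rmin d b)) as [N1 HN1]; [now apply Rmin_pos|].
    pose (k := Nat.max N N1). specialize (HN1 k ltac:(unfold k; lia)).
    assert (S1 : 1 = 1 \/ 1 = -1) by auto.
    assert (D := hair_end_dist 1 k S1). assert (M1 := Rmin_l d b). assert (M2 := Rmin_r d b).
    assert (Bh := broom_hair_end 1 k S1). fold (hair_end 1 k) in Bh.
    exists (hair_end 1 k). repeat split; auto; [lra|].
    destruct (HN 1 k 1 S1) as [_ Hrat]; [unfold k; lia | lra|].
    assert (XK : X (K 1 (E (hair_end 1 k)))) by auto.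
    rewrite (RE _ XK).
    + apply Ea; auto. apply (Eb (1, hair_end 1 k)); [split; auto|].
      apply Rmax_lub_lt; cbn [fst snd]; [|lra]. unfold dR. rewrite Rminus_diag, Rabs_R0; auto.
    + intros Z. rewrite Z, ratio_center in Hrat. assert (A := inv_INR_pos k). lra.
Qed.

(** Pushing [f (a_n)] and [f (b_n)] to a common point and mapping back by [g] would join
    the two kinds of hairs by paths close to the centre. *)
Lemma center_image_not_pushable (X Y : pt3 -> Prop) E rho f g :
  bristle d3 X E rho -> cmap X Y f -> cmap Y X g ->
  homotopic X X (compose g f) (fun x => x) ->
  ~ locally_pushable Y (f (E (0, 0))).
Proof.
  intros HB [f1 f2] [g1 g2] Hh [r [G [Hr [PG G01]]]].
  apply homotopic_reverse in Hh. destruct Hh as [K [K1 [K2 K3]]].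
  assert (K2' := homotopic_cont_at X X K K2).
  assert (PF := path_family_homotopy_at_bristle X E rho K HB K1 K2').
  destruct HB as [E1 [E2 [R1 [R2 [ER RE]]]]].
  assert (Bc := broom_center).
  set (z := f (E (0, 0))) in *.
  assert (CfE : cont_at d2 d3 broom (fun p => f (E p)) (0, 0)).
  { apply (cont_at_comp d2 d3 d3 broom X E f); auto; intros e He; [apply E2 | apply f2]; auto. }
  destruct (CfE r Hr) as [a [Ha Ea]]. fold z in Ea.
  assert (Hz : Y z /\ d3 z z < r) by (split; [apply f1; auto | now rewrite d3_refl]).
  assert (Hcenter : broom (0, 0) /\ d2 (0, 0) (0, 0) < a).
  { split; auto. now rewrite d2_refl. }
  assert (P2 : path_family d2 d2 (fun p => broom p /\ d2 (0, 0) p < a) (0, 0) broom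
                 (fun t p => rho (g (G t (f (E p)))))).
  { apply (path_family_post d2 d3 d2 _ _ X broom
            (fun t p => g (G t (f (E p)))) rho); auto.
    apply (path_family_post d2 d3 d3 _ _ Y X (fun t p => G t (f (E p))) g); auto.
    apply (path_family_pre d3 d3 d2 _ z Y _ (0, 0) G (fun p => f (E p)) PG); auto.
    - intros p [Hp Hd]. split; auto.
    - eapply cont_at_subset; [exact CfE | tauto]. }
  assert (P1 : path_family d2 d2 (fun p => broom p /\ d2 (0, 0) p < a) (0, 0) broom
                 (fun t p => rho (K t (E p)))).
  { eapply path_family_subset; [exact PF | tauto]. }
  (* Each point runs along the homotopy from itself to its image under [g] after [f], then along the
     [g]-image of its push; [rho] turns this into paths in the model broom. *)
  assert (PC := path_family_concat d2 d2 _ _ _ _ _ Hcenter P1 P2).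
  destruct (broom_rigid a (concat (fun t p => rho (K t (E p)))
              (fun t p => rho (g (G t (f (E p)))))) Ha) as [N HN].
  - apply PC. intros p [Hp Hd]. destruct (K3 (E p)) as [_ ->]; auto.
    unfold compose. destruct (G01 (f (E p))) as [-> _]; auto.
  - intros p Hp Hd. rewrite concat_0. destruct (K3 (E p)) as [-> _]; auto.
  - destruct (inv_INR_small a Ha) as [N1 HN1].
    pose (k := Nat.max N N1). specialize (HN1 k ltac:(unfold k; lia)).
    (* All pushes end at the same point, so one number would have to equal both [/ INR (S k)] and
       its negative. *)
    assert (H : forall sg, (sg = 1 \/ sg = -1) ->
              ratio (rho (g (G 1 z))) = sg * / INR (S k)).
    { intros sg Hsg. destruct (HN sg k 1 Hsg) as [_ <-]; [unfold k; lia | lra|].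
      rewrite concat_1. assert (D := hair_end_dist sg k Hsg).
      destruct (G01 (f (E (hair_end sg k)))) as [_ ->]; auto.
      - apply f1, E1, broom_hair_end, Hsg.
      - apply Ea; [apply broom_hair_end, Hsg | lra]. }
    assert (H1 := H 1 ltac:(auto)). assert (H2 := H (-1) ltac:(auto)).
    assert (A := inv_INR_pos k). lra.
Qed.

(** * Pushing along the two cones of a broom *)

Definition cone (sg : R) (q : pt2) : Prop :=
  exists u s, slope u /\ 0 <= s <= 1 /\ q = (sg * (u * (1 - s)), sg * s).

Lemma broom_cone q : broom q <-> exists sg, (sg = 1 \/ sg = -1) /\ cone sg q.
Proof.
  rewrite broom_iff. split.
  - intros [sg [u [s [H1 [H2 [H3 H4]]]]]]. exists sg. split; auto. exists u, s; auto.
  - intros [sg [H1 [u [s [H2 [H3 H4]]]]]]. exists sg, u, s; auto.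
Qed.

Lemma cone_sign sg q : (sg = 1 \/ sg = -1) -> cone sg q -> 0 <= sg * fst q /\ 0 <= sg * snd q.
Proof.
  intros Hsg [u [s [Hu [Hs ->]]]]. apply slope_bounds in Hu. cbn [fst snd].
  destruct Hsg as [-> | ->]; nra.
Qed.

Definition to_apex (sg t : R) (q : pt2) : pt2 :=
  ((1 - t) * fst q, (1 - t) * snd q + t * sg).

(** A cone is star-shaped about its apex: the segment to the apex runs along a hair, raising [s] and
    keeping [u]. *)
Lemma to_apex_path_family sg p : (sg = 1 \/ sg = -1) -> cone sg p ->
  path_family d2 d2 (cone sg) p broom (to_apex sg).
Proof.
  intros Hsg Hp. apply path_family_of_joint; auto.
  - apply d2_refl.
  - intros t q Ht [u [s [Hu [Hs ->]]]]. apply broom_cone. exists sg. split; auto.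
    unfold unit_interval in Ht.
    exists u, ((1 - t) * s + t). split; auto. split; [nra|].
    unfold to_apex. cbn [fst snd]. f_equal; ring.
  - intros t q Ht Hq. unfold to_apex. cont.
Qed.

(** Near such a point [rho] avoids the centre, so [Y] is there only a piece of one cone, which
    contracts to its apex. *)
Lemma bristle_pushable (Y : pt3 -> Prop) E rho p :
  bristle d3 Y E rho -> broom p -> p <> (0, 0) -> locally_pushable Y (E p).
Proof.
  intros [E1 [E2 [R1 [R2 [ER RE]]]]] Hp Hp0.
  destruct (proj1 (broom_cone p) Hp) as [sg [Hsg Hc]].
  destruct (cone_sign sg p Hsg Hc) as [S1 S2].
  assert (Hm : exists m, 0 < m /\ forall q, broom q -> d2 p q < m -> cone sg q /\ q <> (0, 0)).
  (* Positive because [p] is not the centre. Within this distance the dominating coordinate keeps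
     the sign [sg], which no point of the opposite cone has. *)
  { exists (Rmax (sg * fst p) (sg * snd p)). split.
    - destruct (Rle_lt_dec (Rmax (sg * fst p) (sg * snd p)) 0) as [L | L]; auto.
      exfalso. apply Hp0. assert (A := Rmax_l (sg * fst p) (sg * snd p)).
      assert (B := Rmax_r (sg * fst p) (sg * snd p)).
      destruct p as [x y]; cbn [fst snd] in *. destruct Hsg as [-> | ->]; f_equal; lra.
    - intros q Hq Hd. assert (A := Rle_lt_trans _ _ _ (d2_fst p q) Hd).
      assert (B := Rle_lt_trans _ _ _ (d2_snd p q) Hd).
      assert (C : 0 < sg * fst q \/ 0 < sg * snd q).
      { apply Rabs_def2 in A. apply Rabs_def2 in B. revert A B.
        unfold Rmax; destruct Rle_dec; intros; destruct Hsg as [-> | ->]; lra. }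
      split.
      + destruct (proj1 (broom_cone q) Hq) as [sg' [Hsg' Hc']].
        assert (sg' = sg); [|now subst].
        destruct (cone_sign sg' q Hsg' Hc') as [D1 D2].
        destruct Hsg as [-> | ->], Hsg' as [-> | ->]; auto; lra.
      + intros ->. cbn [fst snd] in C. lra. }
  destruct Hm as [m [Hm Hq]].
  destruct (R2 (E p) (E1 p Hp) m Hm) as [r [Hr Er]]. rewrite ER in Er; auto.
  exists r, (fun t y => E (to_apex sg t (rho y))). split; auto. split.
  - apply (path_family_pre d2 d3 d3 (cone sg) p Y _ (E p)
             (fun t q => E (to_apex sg t q)) rho); auto.
    + apply (path_family_post d2 d2 d3 _ p broom Y (to_apex sg) E); auto.
      now apply to_apex_path_family.
    + intros y [Hy Hd]. apply Hq; auto.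
    + apply cont_at_subset with (X := Y); [|tauto]. intros e He. apply R2; auto.
  - intros y Hy Hd. split.
    + rewrite (RE y Hy) at 2.
      * f_equal. unfold to_apex. rewrite (surjective_pairing (rho y)) at 3. f_equal; ring.
      * apply Hq; auto.
    + rewrite ER; auto. unfold to_apex. f_equal. f_equal; ring.
Qed.

(** The hairs of a cone meet only at the apex, so the path climbs to the apex and returns along the
    central segment. *)
Lemma broom_path_to_center q : broom q ->
  exists c : R -> pt2, c 0 = q /\ c 1 = (0, 0) /\
    (forall t, unit_interval t -> broom (c t)) /\
    (forall t, unit_interval t -> cont_at dR d2 unit_interval c t).
Proof.
  intros Hq. destruct (proj1 (broom_cone q) Hq) as [sg [Hsg Hc]].
  assert (Hv : cone sg (0, 0)).
  { exists 0, 0. split; [now left|]. split; [lra|]. f_equal; ring. }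
  assert (P1 : path_family d2 d2 (fun p => p = q) q broom (to_apex sg)).
  { eapply path_family_subset; [now apply to_apex_path_family|]. now intros x ->. }
  assert (P2 : path_family d2 d2 (fun p => p = q) q broom (fun t _ => to_apex sg (1 - t) (0, 0))).
  { destruct (to_apex_path_family sg (0, 0) Hsg Hv) as [A _].
    apply path_family_of_joint; auto.
    - apply d2_refl.
    - intros t x Ht _. apply A; auto. unfold unit_interval in *; lra.
    - intros. unfold to_apex. cont. }
  destruct (path_family_concat d2 d2 _ q _ _ _ (eq_refl q) P1 P2) as [A [B _]].
  - intros x ->. unfold to_apex. cbn [fst snd]. f_equal; ring.
  - eexists (fun t => concat (to_apex sg) (fun t _ => to_apex sg (1 - t) (0, 0)) t q).
    repeat split; auto.
    + rewrite concat_0. unfold to_apex. rewrite (surjective_pairing q) at 3. f_equal; ring.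
    + rewrite concat_1. unfold to_apex. cbn [fst snd]. f_equal; ring.
Qed.

(** * A trunk with brooms attached *)

Section Bristled.
Context {J : Type} (ok : J -> Prop) (E : J -> pt2 -> pt3) (Y T : pt3 -> Prop).
Hypothesis HY : forall y, Y y <-> T y \/ exists j q, ok j /\ broom q /\ y = E j q.
Hypothesis HE : forall j, ok j -> cont_on d2 d3 broom (E j).
Hypothesis HT : forall j, ok j -> T (E j (0, 0)).

(** The last clause confines the path to the broom of its start, which later bounds its size. *)
Lemma path_to_trunk y : Y y -> exists c : R -> pt3, c 0 = y /\ T (c 1) /\
  (forall t, unit_interval t -> Y (c t)) /\
  (forall t, unit_interval t -> cont_at dR d3 unit_interval c t) /\
  ((forall t, c t = y) \/
   exists j q, ok j /\ broom q /\ y = E j q /\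
     forall t, unit_interval t -> exists q', broom q' /\ c t = E j q').
Proof.
  intros Hy. destruct (proj1 (HY y) Hy) as [Ht | [j [q [Hj [Hq ->]]]]].
  - exists (fun _ => y). repeat split; auto.
    intros t _ e He. exists 1. split; [lra|]. intros; now rewrite d3_refl.
  - destruct (broom_path_to_center q Hq) as [c [C0 [C1 [C2 C3]]]].
    exists (fun t => E j (c t)). rewrite C0, C1. repeat split; auto.
    + intros t Ht. apply HY. right. exists j, (c t). auto.
    + intros t Ht. apply (cont_at_comp dR d2 d3 _ broom c (E j)); auto.
      intros e He. apply HE; auto.
    + right. exists j, q. repeat split; auto. intros t Ht. exists (c t). auto.
Qed.

(** Points are brought to the trunk along chosen paths that depend on the start in no continuous
    way. Continuity at [z] survives because [z] itself does not move and a broom that comes near [z]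
    is small, so its points stay near [z] on their way. The trunk is then contracted by [G]. *)
Lemma trunk_pushable z (G : R -> pt3 -> pt3) :
  T z ->
  (forall eps, 0 < eps -> exists d, 0 < d /\ forall j q, ok j -> broom q ->
     d3 z (E j q) < d -> forall q', broom q' -> d3 z (E j q') < eps) ->
  (forall j q, ok j -> broom q -> z = E j q -> False) ->
  path_family d3 d3 T z Y G ->
  (forall y, T y -> G 0 y = y /\ G 1 y = G 1 z) ->
  locally_pushable Y z.
Proof.
  intros Hz Hsmall Hnc PG G01.
  assert (Hc : forall y, exists c : R -> pt3, Y y -> c 0 = y /\ T (c 1) /\
    (forall t, unit_interval t -> Y (c t)) /\
    (forall t, unit_interval t -> cont_at dR d3 unit_interval c t) /\
    ((forall t, c t = y) \/
     exists j q, ok j /\ broom q /\ y = E j q /\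
       forall t, unit_interval t -> exists q', broom q' /\ c t = E j q')).
  { intros y. destruct (classic (Y y)) as [Hy | Hy].
    - destruct (path_to_trunk y Hy) as [c Hc]. exists c. auto.
    - exists (fun _ => y). tauto. }
  pose (c := fun y => proj1_sig (constructive_indefinite_description _ (Hc y))).
  assert (Hcs : forall y, Y y -> c y 0 = y /\ T (c y 1) /\
    (forall t, unit_interval t -> Y (c y t)) /\
    (forall t, unit_interval t -> cont_at dR d3 unit_interval (c y) t) /\
    ((forall t, c y t = y) \/
     exists j q, ok j /\ broom q /\ y = E j q /\
       forall t, unit_interval t -> exists q', broom q' /\ c y t = E j q')).
  { intros y. exact (proj2_sig (constructive_indefinite_description _ (Hc y))). }
  clearbody c. clear Hc.
  assert (Yz : Y z) by (apply HY; auto).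
  assert (Hcz : forall t, c z t = z).
  { destruct (Hcs z Yz) as [_ [_ [_ [_ [A | [j [q [Hj [Hq [A _]]]]]]]]]]; auto.
    exfalso. eauto. }
  assert (Hlim : forall eps, 0 < eps -> exists d, 0 < d /\ forall y t,
            Y y -> d3 z y < d -> unit_interval t -> d3 z (c y t) < eps).
  { intros eps He. destruct (Hsmall eps He) as [d [Hd H1]].
    exists (Rmin d eps). split; [now apply Rmin_pos|].
    intros y t Hy Hzy Ht.
    destruct (Hcs y Hy) as [_ [_ [_ [_ [A | [j [q [Hj [Hq [A B]]]]]]]]]].
    - rewrite A. eapply Rlt_le_trans; [exact Hzy | apply Rmin_r].
    - destruct (B t Ht) as [q' [Hq' ->]]. apply (H1 j q); auto.
      rewrite <- A. eapply Rlt_le_trans; [exact Hzy | apply Rmin_l]. }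
  assert (I1 : unit_interval 1) by (unfold unit_interval; lra).
  (* The radius is arbitrary: [G] contracts the whole trunk, so every point of [Y] is pushed. *)
  exists 1, (concat (fun t y => c y t) (fun t y => G t (c y 1))). split; [lra|]. split.
  - apply path_family_concat.
    + split; auto. rewrite d3_refl. lra.
    + split; [|split].
      * intros t y Ht [Hy _]. now apply Hcs.
      * intros t y Ht [Hy _]. now apply Hcs.
      * intros t Ht eps He. cbn [fst snd]. rewrite Hcz.
        destruct (Hlim eps He) as [d [Hd H1]]. exists d. split; auto.
        intros [s y] [Hs [Hy _]] Hd'. apply H1; auto.
        eapply Rle_lt_trans; [apply Rmax_r | exact Hd'].
    + apply (path_family_pre d3 d3 d3 T z Y _ z G (fun y => c y 1)); auto.
      * intros y [Hy _]. now apply Hcs.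
      * intros eps He. rewrite Hcz. destruct (Hlim eps He) as [d [Hd H1]].
        exists d. split; auto. intros y [Hy _] Hzy. auto.
    + intros y [Hy _]. destruct (Hcs y Hy) as [_ [A _]].
      now destruct (G01 _ A) as [-> _].
  - intros y Hy _. rewrite concat_0, !concat_1. destruct (Hcs y Hy) as [A [B _]].
    split; auto. rewrite Hcz. now apply G01.
Qed.

End Bristled.

(** * The hairy disk *)

Lemma nonslope_isolated (u : R) : ~ slope u ->
  exists d, 0 < d /\ forall u', slope u' -> Rabs (u' - u) < d -> False.
Proof.
  intros Hu. assert (Hu0 : u <> 0) by (intros ->; apply Hu; now left).
  destruct (inv_INR_isolated u Hu0) as [e [He H1]].
  exists (Rmin e (Rabs u)). split; [apply Rmin_pos; auto; now apply Rabs_pos_lt|].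
  intros u' Hu' Hd.
  assert (D1 := Rlt_le_trans _ _ _ Hd (Rmin_l _ _)).
  assert (D2 := Rlt_le_trans _ _ _ Hd (Rmin_r _ _)).
  destruct Hu' as [-> | [k ->]].
  - rewrite Rminus_0_l, Rabs_Ropp in D2. lra.
  - apply Hu. right. exists k. symmetry. auto.
Qed.

(** The cone is parametrized by the pairs of a slope and a height, a compact subset of the unit
    square; so its image is compact and has positive distance from [z]. *)
Lemma cone_image_closed (sg : R) (e : pt2 -> pt2) (z : pt2) : (sg = 1 \/ sg = -1) ->
  cont_on d2 d2 broom e -> (forall p, broom p -> e p <> z) ->
  exists d, 0 < d /\ forall p, cone sg p -> d <= d2 z (e p).
Proof.
  intros Hsg Ce Hz.
  pose (q := fun u s => (sg * (u * (1 - s)), sg * s) : pt2).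
  (* A gauge on all real pairs. At a slope it is at most half the distance from [z] to the image
     point, shrunk by continuity; elsewhere it only keeps the cell free of slopes. *)
  assert (Hloc : forall u v, exists d : posreal, 0 <= v <= 1 ->
    forall u' v', slope u' -> 0 <= v' <= 1 -> Rabs (u' - u) < d -> Rabs (v' - v) < d ->
      d <= d2 z (e (q u' v'))).
  { intros u v. destruct (classic (slope u)) as [Hu | Hu].
    - destruct (classic (0 <= v <= 1)) as [Hv | Hv].
      2: { exists (mkposreal 1 Rlt_0_1). tauto. }
      assert (Hq : forall u' v', slope u' -> 0 <= v' <= 1 -> broom (q u' v')).
      { intros u' v' Hu' Hv'. apply broom_cone. exists sg. split; auto. exists u', v'; auto. }
      assert (Hr : 0 < d2 z (e (q u v))).
      { apply Rnot_le_lt. intros N. apply (Hz (q u v)); auto. symmetry. now apply d2_eq. }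
      assert (C : cont_at (dprod dR) d2 (fun a => slope (fst a) /\ 0 <= snd a <= 1)
                    (fun a => e (q (fst a) (snd a))) (u, v)).
      { apply (cont_at_comp (dprod dR) d2 d2 _ broom (fun a => q (fst a) (snd a)) e).
        - unfold q. cont.
        - intros [a b] [A B]; auto.
        - intros eps He. apply Ce; auto. }
      destruct (C (d2 z (e (q u v)) / 2)) as [d [Hd H1]]; [lra|].
      assert (Hm : 0 < Rmin d (d2 z (e (q u v)) / 2)) by (apply Rmin_pos; lra).
      exists (mkposreal _ Hm). cbn [pos]. intros _ u' v' Hu' Hv' Du Dv.
      assert (D : d2 (e (q u v)) (e (q u' v')) < d2 z (e (q u v)) / 2).
      { apply (H1 (u', v')); [split; auto|].
        apply Rmax_lub_lt; cbn [fst snd]; unfold dR; rewrite Rabs_minus_sym;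
          (eapply Rlt_le_trans; [eassumption | apply Rmin_l]). }
      assert (Tr := d2_triangle z (e (q u' v')) (e (q u v))).
      rewrite (d2_sym (e (q u' v'))) in Tr.
      assert (M := Rmin_r d (d2 z (e (q u v)) / 2)). lra.
    - destruct (nonslope_isolated u Hu) as [d [Hd H1]].
      exists (mkposreal d Hd). intros _ u' v' Hu' _ Du _. exfalso. eauto. }
  pose (del := fun u v => proj1_sig (constructive_indefinite_description _ (Hloc u v))).
  assert (Hdel : forall u v, 0 <= v <= 1 -> forall u' v', slope u' -> 0 <= v' <= 1 ->
    Rabs (u' - u) < del u v -> Rabs (v' - v) < del u v ->
      del u v <= d2 z (e (q u' v'))).
  { intros u v. exact (proj2_sig (constructive_indefinite_description _ (Hloc u v))). }
  destruct (compactness_value_2d 0 1 0 1 del) as [d Hd].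
  exists d. split; [apply cond_pos|]. intros p [u [s [Hu [Hs ->]]]].
  apply Rnot_lt_le. intros Hlt.
  (* The cell containing [(u, s)] is given under a double negation, which suffices for a
     contradiction. *)
  apply (Hd u s (slope_bounds u Hu) Hs). intros [u0 [v0 [_ [Hv0 [A [B C]]]]]].
  assert (D := Hdel u0 v0 Hv0 u s Hu Hs A B). fold (q u s) in Hlt. lra.
Qed.

Lemma broom_image_closed (e : pt2 -> pt2) (z : pt2) :
  cont_on d2 d2 broom e -> (forall p, broom p -> e p <> z) ->
  exists d, 0 < d /\ forall p, broom p -> d <= d2 z (e p).
Proof.
  intros Ce Hz.
  destruct (cone_image_closed 1 e z) as [a [Ha H1]]; auto.
  destruct (cone_image_closed (-1) e z) as [b [Hb H2]]; auto.
  exists (Rmin a b). split; [now apply Rmin_pos|]. intros p Hp.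
  destruct (proj1 (broom_cone p) Hp) as [sg [[-> | ->] Hc]].
  - eapply Rle_trans; [apply Rmin_l | auto].
  - eapply Rle_trans; [apply Rmin_r | auto].
Qed.

Lemma disk2_norm p : disk2 p <-> d2 p (0, 0) <= 1.
Proof.
  unfold disk2, d2. cbn [fst snd]. rewrite !Rminus_0_r. split; intros H.
  - apply sqrt_le_of_sq; lra.
  - assert (A := pow2_ge_0 (fst p)). assert (B := pow2_ge_0 (snd p)).
    rewrite <- (pow2_sqrt (fst p ^ 2 + snd p ^ 2)); [|lra].
    rewrite <- (pow1 2). apply pow_incr. split; [apply sqrt_pos | exact H].
Qed.

Section HairyDisk.
Context (H : pt2 -> Prop) (m : nat -> pt2) (e : nat -> pt2 -> pt2).
Context (Hm : forall i, circle2 (m i))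
  (Hdense : forall p, circle2 p -> forall eps, 0 < eps -> exists i, d2 (m i) p < eps)
  (Hemb : forall i, embedding2 broom (e i))
  (Hcent : forall i, e i (0, 0) = m i)
  (Hdisj : forall i j p q, i <> j -> broom p -> broom q -> e i p <> e j q)
  (Hdisk : forall i p, broom p -> disk2 (e i p) -> e i p = m i)
  (Hdiam : forall eps, 0 < eps -> exists N, forall i, (N <= i)%nat ->
       forall p q, broom p -> broom q -> d2 (e i p) (e i q) < eps)
  (HH : forall r, H r <-> disk2 r \/ exists i p, broom p /\ r = e i p).

Lemma e_cont i : cont_on d2 d2 broom (e i).
Proof. apply Hemb. Qed.

Lemma e_inj i p q : broom p -> broom q -> e i p = e i q -> p = q.
Proof.
  intros Hp Hq E. destruct (Hemb i) as [_ [g [_ G]]].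
  rewrite <- (G p), <- (G q), E; auto.
Qed.

Lemma m_disk i : disk2 (m i).
Proof. unfold disk2. rewrite (Hm i). lra. Qed.

Lemma m_inj i j : m i = m j -> i = j.
Proof.
  intros E. destruct (Nat.eq_dec i j) as [|N]; auto. exfalso.
  apply (Hdisj i j (0, 0) (0, 0) N); try apply broom_center. now rewrite !Hcent.
Qed.

(** Finitely many compact sets missing [z] have a common positive distance from it. [P] allows a
    broom through [z] to be left out. *)
Lemma hairs_away (z : pt2) (P : nat -> Prop) (N : nat) :
  (forall j p, P j -> broom p -> e j p <> z) ->
  exists d, 0 < d /\ forall j p, (j < N)%nat -> P j -> broom p -> d <= d2 z (e j p).
Proof.
  intros Hz.
  destruct (finite_min (fun j d => P j -> forall p, broom p -> d <= d2 z (e j p)) N)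
    as [d [Hd H1]].
  - intros i a b A Hb HP p Hp. specialize (A HP p Hp). lra.
  - intros i _. destruct (classic (P i)) as [HP | HP].
    + destruct (broom_image_closed (e i) z (e_cont i)) as [d [Hd H1]].
      * intros p Hp. now apply Hz.
      * exists d. auto.
    + exists 1. split; [lra | tauto].
  - exists d. split; auto.
Qed.

(** The point lies outside the disk. Brooms of small diameter hang too close to the disk to reach
    it, and the finitely many others are compact and disjoint from its broom. *)
Lemma broom_isolated_in_hairy_disk i p : broom p -> p <> (0, 0) ->
  exists d, 0 < d /\ forall y, H y -> d2 (e i p) y < d -> exists q, broom q /\ y = e i q.
Proof.
  intros Hp Hp0. set (z := e i p).
  assert (Hzd : ~ disk2 z).
  { intros D. apply Hp0, (e_inj i); auto using broom_center. rewrite Hcent. now apply Hdisk. }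
  assert (Hz : 1 < d2 z (0, 0)).
  { apply Rnot_le_lt. intros L. apply Hzd. now apply disk2_norm. }
  set (a := d2 z (0, 0) - 1).
  assert (Ha : forall y, disk2 y -> a <= d2 z y).
  { intros y Hy. apply disk2_norm in Hy. assert (T := d2_triangle z y (0, 0)). unfold a. lra. }
  destruct (Hdiam (a / 2)) as [N HN]; [unfold a; lra|].
  destruct (hairs_away z (fun j => j <> i) N) as [b [Hb H1]].
  { intros j q Hj Hq E. apply (Hdisj j i q p); auto. }
  exists (Rmin b (a / 2)). split; [apply Rmin_pos; unfold a in *; lra|].
  intros y Hy Hd.
  assert (D1 := Rlt_le_trans _ _ _ Hd (Rmin_l _ _)).
  assert (D2 := Rlt_le_trans _ _ _ Hd (Rmin_r _ _)).
  destruct (proj1 (HH y) Hy) as [Dy | [j [q [Hq ->]]]].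
  - assert (A := Ha y Dy). unfold a in *. lra.
  - destruct (Nat.eq_dec j i) as [-> | Hj]; [now exists q|]. exfalso.
    destruct (Nat.lt_ge_cases j N) as [L | L].
    + assert (A := H1 j q L Hj Hq). lra.
    + assert (A := Ha (m j) (m_disk j)). rewrite <- Hcent in A.
      assert (B := HN j L q (0, 0) Hq broom_center).
      assert (T := d2_triangle z (e j q) (e j (0, 0))). lra.
Qed.

Lemma small_hairs z : disk2 z -> (forall j, z <> m j) -> forall eps, 0 < eps ->
  exists d, 0 < d /\ forall j q, broom q -> d2 z (e j q) < d ->
    forall q', broom q' -> d2 z (e j q') < eps.
Proof.
  intros Hz Hnc eps He. destruct (Hdiam (eps / 2)) as [N HN]; [lra|].
  destruct (hairs_away z (fun _ => True) N) as [b [Hb H1]].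
  { intros j p _ Hp E. apply (Hnc j). rewrite <- E. apply Hdisk; auto. now rewrite E. }
  exists (Rmin b (eps / 2)). split; [apply Rmin_pos; lra|].
  intros j q Hq Hd q' Hq'.
  assert (D1 := Rlt_le_trans _ _ _ Hd (Rmin_l _ _)).
  assert (D2 := Rlt_le_trans _ _ _ Hd (Rmin_r _ _)).
  destruct (Nat.lt_ge_cases j N) as [L | L].
  - assert (A := H1 j q L I Hq). lra.
  - assert (B := HN j L q q' Hq Hq'). assert (T := d2_triangle z (e j q) (e j q')). lra.
Qed.

Definition broom_part (i : nat) (y : pt2) : pt2 :=
  match excluded_middle_informative (exists p, broom p /\ y = e i p) with
  | left h => proj1_sig (constructive_indefinite_description _ h)
  | right _ => (0, 0)
  end.

Lemma broom_part_e i p : broom p -> broom_part i (e i p) = p.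
Proof.
  intros Hp. unfold broom_part. destruct excluded_middle_informative as [h | h].
  - destruct constructive_indefinite_description as [q [Hq E]]. cbn [proj1_sig].
    symmetry. now apply (e_inj i).
  - exfalso. apply h. now exists p.
Qed.

Lemma broom_part_out i y : ~ (exists p, broom p /\ y = e i p) -> broom_part i y = (0, 0).
Proof.
  intros N. unfold broom_part. now destruct excluded_middle_informative.
Qed.

Lemma broom_part_disk i y : disk2 y -> broom_part i y = (0, 0).
Proof.
  intros Hy. destruct (classic (exists p, broom p /\ y = e i p)) as [[p [Hp ->]] | N].
  - rewrite (Hdisk i p), <- Hcent; auto. apply broom_part_e, broom_center.
  - now apply broom_part_out.
Qed.

(** Continuity of the retraction has three cases. At [m i] the inverse embedding handles the broom
    and all other points go exactly to the centre; at other points of the broom the broom is a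
    neighbourhood; off the broom its image is closed. *)
Lemma hairy_disk_bristle i : bristle d2 H (e i) (broom_part i).
Proof.
  assert (Hin : forall p, broom p -> H (e i p)).
  { intros p Hp. apply HH. right. now exists i, p. }
  split; [exact Hin|]. split; [apply e_cont|]. split; [|split; [|split]].
  - intros y _. destruct (classic (exists p, broom p /\ y = e i p)) as [[p [Hp ->]] | N].
    + now rewrite broom_part_e.
    + rewrite broom_part_out; auto using broom_center.
  - intros y Hy eps He.
    destruct (classic (exists p, broom p /\ y = e i p)) as [[p [Hp ->]] | N].
    + rewrite broom_part_e; auto. destruct (Hemb i) as [_ [g [Cg G]]].
      destruct (Cg (e i p) (ex_intro _ p (conj Hp eq_refl)) eps He) as [d [Hd H1]].
      rewrite G in H1; auto.
      destruct (classic (p = (0, 0))) as [-> | Hp0].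
      * exists d. split; auto. intros y' Hy' Hd'.
        destruct (classic (exists p, broom p /\ y' = e i p)) as [[p' [Hp' ->]] | N].
        -- rewrite broom_part_e; auto. rewrite <- (G p') by auto. apply H1; auto. now exists p'.
        -- rewrite broom_part_out, d2_refl; auto.
      * destruct (broom_isolated_in_hairy_disk i p Hp Hp0) as [b [Hb H2]].
        exists (Rmin d b). split; [now apply Rmin_pos|]. intros y' Hy' Hd'.
        destruct (H2 y' Hy') as [p' [Hp' ->]].
        { eapply Rlt_le_trans; [exact Hd' | apply Rmin_r]. }
        rewrite broom_part_e; auto. rewrite <- (G p') by auto. apply H1; [now exists p'|].
        eapply Rlt_le_trans; [exact Hd' | apply Rmin_l].
    + destruct (broom_image_closed (e i) y (e_cont i)) as [d [Hd H1]].
      { intros p Hp E. apply N. now exists p. }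
      exists d. split; auto. intros y' Hy' Hd'. rewrite !broom_part_out, d2_refl; auto.
      intros [p [Hp ->]]. specialize (H1 p Hp). lra.
  - intros p Hp. now apply broom_part_e.
  - intros y Hy Hn. destruct (classic (exists p, broom p /\ y = e i p)) as [[p [Hp ->]] | N].
    + now rewrite broom_part_e.
    + exfalso. apply Hn. now apply broom_part_out.
Qed.

(** Rotating [m i] by the angle with tangent half-angle [s] gives a circle point near [m i]. *)
Lemma centers_not_isolated i eps : 0 < eps -> exists j, j <> i /\ d2 (m i) (m j) < eps.
Proof.
  (* The rotated point turns out to be within [4 * b <= 8 * s] of [m i], that is, within
     [eps / 2]. *)
  intros He. pose (s := Rmin 1 (eps / 16)).
  assert (Hs : 0 < s) by (unfold s; apply Rmin_pos; lra).
  assert (Hs1 : s <= 1) by apply Rmin_l. assert (Hs2 : s <= eps / 16) by apply Rmin_r.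
  clearbody s.
  pose (a := (1 - s ^ 2) / (1 + s ^ 2)). pose (b := 2 * s / (1 + s ^ 2)).
  assert (Hp : 0 < 1 + s ^ 2) by nra.
  assert (Hab : a ^ 2 + b ^ 2 = 1) by (unfold a, b; field; lra).
  assert (Ha : 1 - a = b * s) by (unfold a, b; field; lra).
  assert (Hb : 0 < b) by (unfold b; apply Rdiv_lt_0_compat; lra).
  assert (Hb2 : b <= 2 * s).
  { unfold b. apply Rmult_le_reg_r with (1 + s ^ 2); auto.
    unfold Rdiv. rewrite Rmult_assoc, Rinv_l; nra. }
  clearbody a b.
  assert (C := Hm i). unfold circle2 in C.
  set (x := fst (m i)) in *. set (y := snd (m i)) in *.
  pose (p := (a * x - b * y, b * x + a * y) : pt2).
  assert (Cp : circle2 p).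
  { unfold circle2, p. cbn [fst snd].
    transitivity ((a ^ 2 + b ^ 2) * (x ^ 2 + y ^ 2)); [ring|]. rewrite Hab, C; ring. }
  assert (Bx : -1 <= x <= 1) by nra. assert (By : -1 <= y <= 1) by nra.
  assert (Hd0 : 0 < d2 (m i) p).
  { apply Rnot_le_lt. intros L. apply d2_eq in L.
    assert (X : x = a * x - b * y) by (unfold x at 1; rewrite L; reflexivity).
    assert (Y : y = b * x + a * y) by (unfold y at 1; rewrite L; reflexivity). nra. }
  assert (Hd1 : d2 (m i) p <= eps / 2).
  { assert (L := d2_le (m i) p). fold x y in L. unfold p in L at 2 3. cbn [fst snd] in L.
    fold x y in L.
    assert (A1 : Rabs (x - (a * x - b * y)) <= 2 * b).
    { replace (x - (a * x - b * y)) with (b * (s * x + y)).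
      - rewrite Rabs_mult, (Rabs_pos_eq b); [|lra].
        assert (Rabs (s * x + y) <= 2) by (apply Rabs_le; nra). nra.
      - transitivity ((b * s) * x + b * y); [ring|]. rewrite <- Ha. ring. }
    assert (A2 : Rabs (y - (b * x + a * y)) <= 2 * b).
    { replace (y - (b * x + a * y)) with (b * (s * y - x)).
      - rewrite Rabs_mult, (Rabs_pos_eq b); [|lra].
        assert (Rabs (s * y - x) <= 2) by (apply Rabs_le; nra). nra.
      - transitivity ((b * s) * y - b * x); [ring|]. rewrite <- Ha. ring. }
    lra. }
  (* A centre nearer to [p] than [m i] is cannot be [m i] itself. *)
  destruct (Hdense p Cp (Rmin (eps / 4) (d2 (m i) p))) as [j Hj].
  { apply Rmin_pos; lra. }
  assert (D1 := Rlt_le_trans _ _ _ Hj (Rmin_l _ _)).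
  assert (D2 := Rlt_le_trans _ _ _ Hj (Rmin_r _ _)).
  exists j. split; [intros ->; lra|].
  assert (T := d2_triangle (m i) p (m j)). rewrite (d2_sym p) in T. lra.
Qed.

End HairyDisk.

Lemma cont_at_local {T U : Type} (dT : T -> T -> R) (dU : U -> U -> R)
  (X : T -> Prop) (f : T -> U) x r : 0 < r ->
  cont_at dT dU (fun y => X y /\ dT x y < r) f x -> cont_at dT dU X f x.
Proof.
  intros Hr Hf eps He. destruct (Hf eps He) as [d [Hd H1]].
  exists (Rmin d r). split; [now apply Rmin_pos|]. intros y Hy Hxy.
  apply H1; [split; auto|]; (eapply Rlt_le_trans; [exact Hxy|]); [apply Rmin_r | apply Rmin_l].
Qed.

(** * The four spaces *)

(** The flag [a] adds the extra broom with its arc, the flag [o] adds the origin. *)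
Definition axis (a o : bool) (x : R) : Prop :=
  (if a then -2 else -1) <= x /\ (x < 0 \/ (o = true /\ x = 0)).

Lemma axis_convex a o x y t : axis a o x -> axis a o y -> 0 <= t <= 1 ->
  axis a o (x + t * (y - x)).
Proof.
  intros [A1 A2] [B1 B2] Ht. split; [destruct a; nra|].
  destruct (Req_dec (x + t * (y - x)) 0) as [E | E].
  - right. split; auto. destruct A2 as [A2 | [? _]]; auto.
    destruct B2 as [B2 | [? _]]; auto. exfalso. nra.
  - left. assert (x <= 0) by lra. assert (y <= 0) by lra. nra.
Qed.

Lemma axis_plane a o n : axis a o (- / INR (S n)).
Proof.
  assert (A := inv_INR_pos n). assert (B := inv_INR_le_1 n).
  split; [destruct a; lra | left; lra].
Qed.

Lemma plane_isolated x0 : x0 <> 0 -> exists d, 0 < d /\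
  forall k, Rabs (- / INR (S k) - x0) < d -> - / INR (S k) = x0.
Proof.
  intros Hx. destruct (inv_INR_isolated (- x0)) as [d [Hd H1]]; [lra|].
  exists d. split; auto. intros k Hk. rewrite <- Rabs_Ropp in Hk.
  replace (- (- / INR (S k) - x0)) with (/ INR (S k) - - x0) in Hk by ring.
  rewrite (H1 k Hk). ring.
Qed.

Section Spaces.
Context (H : pt2 -> Prop) (m : nat -> pt2) (e : nat -> pt2 -> pt2) (D : R).
Context (Hm : forall i, circle2 (m i))
  (Hdense : forall p, circle2 p -> forall eps, 0 < eps -> exists i, d2 (m i) p < eps)
  (Hemb : forall i, embedding2 broom (e i))
  (Hcent : forall i, e i (0, 0) = m i)
  (Hdisj : forall i j p q, i <> j -> broom p -> broom q -> e i p <> e j q)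
  (Hdisk : forall i p, broom p -> disk2 (e i p) -> e i p = m i)
  (Hdiam : forall eps, 0 < eps -> exists N, forall i, (N <= i)%nat ->
       forall p q, broom p -> broom q -> d2 (e i p) (e i q) < eps)
  (HH : forall r, H r <-> disk2 r \/ exists i p, broom p /\ r = e i p)
  (HD : is_diameter H D).

Let Hbristle i := hairy_disk_bristle H m e Hm Hemb Hcent Hdisj Hdisk Hdiam HH i.

Lemma disk_center : disk2 (0, 0).
Proof. unfold disk2. cbn [fst snd]. lra. Qed.

Lemma diameter_bound p q : H p -> H q -> d2 p q <= D.
Proof. intros Hp Hq. apply HD. now exists p, q. Qed.

Lemma D_pos : 0 < D.
Proof.
  apply Rlt_le_trans with (d2 (1, 0) (0, 0)).
  - eapply Rlt_le_trans; [|apply d2_fst]. cbn [fst]. rewrite Rminus_0_r, Rabs_R1. lra.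
  - apply diameter_bound; apply HH; left; [|apply disk_center].
    unfold disk2. cbn [fst snd]. lra.
Qed.

Definition scale (n : nat) : R := / (INR (S n) * D).

Lemma scale_pos n : 0 < scale n.
Proof. apply Rinv_0_lt_compat, Rmult_lt_0_compat; [apply INR_S_pos | apply D_pos]. Qed.

Definition plane (n : nat) (p : pt2) : pt3 :=
  (- / INR (S n), scale n * fst p, scale n * snd p).

Definition unplane (n : nat) (r : pt3) : pt2 := (p2 r / scale n, p3 r / scale n).

Lemma unplane_plane n p : unplane n (plane n p) = p.
Proof.
  assert (A := scale_pos n). unfold unplane, plane, p2, p3. cbn [fst snd].
  rewrite (surjective_pairing p) at 3. f_equal; field; lra.
Qed.

Lemma plane_unplane n r : p1 r = - / INR (S n) -> plane n (unplane n r) = r.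
Proof.
  assert (A := scale_pos n). destruct r as [[x y] z]. unfold unplane, plane, p1, p2, p3.
  cbn [fst snd]. intros ->. f_equal; [f_equal|]; field; lra.
Qed.

Lemma plane_inj n p q : plane n p = plane n q -> p = q.
Proof. intros E. rewrite <- (unplane_plane n p), E. apply unplane_plane. Qed.

Lemma p1_plane n p : p1 (plane n p) = - / INR (S n).
Proof. reflexivity. Qed.

Lemma plane_dist n p q : d3 (plane n p) (plane n q) = scale n * d2 p q.
Proof.
  assert (A := scale_pos n). unfold plane, d3, d2.
  rewrite <- (sqrt_pow2 (scale n)) at 5 by lra.
  rewrite <- sqrt_mult_alt by apply pow2_ge_0. f_equal. ring.
Qed.

(** [None] is the extra broom, [Some (i, n)] the broom at [m i] of the disk in the plane
    [x = - / INR (S n)]. *)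
Definition hair_index : Type := option (nat * nat).

Definition allowed (a : bool) (j : hair_index) : Prop := j = None -> a = true.

Definition hair (j : hair_index) (p : pt2) : pt3 :=
  match j with
  | Some (i, n) => plane n (e i p)
  | None => (-2, fst p, snd p)
  end.

(** What remains when every broom is cut down to its centre. *)
Definition trunk (a o : bool) (r : pt3) : Prop :=
  (exists x, axis a o x /\ r = (x, 0, 0)) \/ exists n p, disk2 p /\ r = plane n p.

Definition space (a o : bool) (r : pt3) : Prop :=
  trunk a o r \/ exists j p, allowed a j /\ broom p /\ r = hair j p.

Lemma space_cases a o r : space a o r <->
  (exists x, axis a o x /\ r = (x, 0, 0)) \/ (exists n q, H q /\ r = plane n q) \/
  (a = true /\ exists q, broom q /\ r = (-2, fst q, snd q)).
Proof.
  split.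
  - intros [[A | [n [p [Hp ->]]]] | [[[i n] |] [p [Hj [Hp ->]]]]]; auto.
    + right; left. exists n, p. split; auto. apply HH. auto.
    + right; left. exists n, (e i p). split; auto. apply HH. right. eauto.
    + right; right. split; [now apply Hj | eauto].
  - intros [A | [[n [q [Hq ->]]] | [Ha [q [Hq ->]]]]].
    + left; left; auto.
    + destruct (proj1 (HH q) Hq) as [Dq | [i [p [Hp ->]]]].
      * left; right; eauto.
      * right. exists (Some (i, n)), p. repeat split; auto. intros ?; discriminate.
    + right. exists None, q. repeat split; auto. intros _; auto.
Qed.

Lemma trunk_axis a o r : trunk a o r -> axis a o (p1 r).
Proof.
  intros [[x [Hx ->]] | [n [p [_ ->]]]]; [exact Hx | apply axis_plane].
Qed.

Lemma hair_cont j : cont_on d2 d3 broom (hair j).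
Proof.
  intros p Hp. destruct j as [[i n] |]; cbn [hair].
  - apply (cont_at_comp d2 d2 d3 broom (fun _ => True) (e i) (plane n)); auto.
    + exact (e_cont e Hemb i p Hp).
    + unfold plane. cont.
  - change (cont_at d2 d3 broom (fun q : pt2 => (-2, fst q, snd q)) p). cont.
Qed.

Lemma hair_center_trunk a o j : allowed a j -> trunk a o (hair j (0, 0)).
Proof.
  intros Hj. destruct j as [[i n] |]; cbn [hair].
  - right. exists n, (m i). rewrite Hcent. split; auto. now apply m_disk.
  - left. exists (-2). cbn [fst snd]. split; auto. rewrite (Hj eq_refl).
    split; [lra | left; lra].
Qed.

Lemma unplane_axis n x : unplane n (x, 0, 0) = (0, 0).
Proof.
  assert (A := scale_pos n). unfold unplane, p2, p3. cbn [fst snd]. f_equal; field; lra.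
Qed.

(** The disk planes accumulate only at [x = 0], so a thin slab around one of them meets just its own
    hairy disk and the axis, whose points project to the disk centre. *)
Lemma space_slab a o n : exists d, 0 < d /\ forall y, space a o y ->
  Rabs (p1 y - - / INR (S n)) < d ->
  H (unplane n y) /\ (p1 y <> - / INR (S n) -> unplane n y = (0, 0)).
Proof.
  destruct (plane_isolated (- / INR (S n))) as [d [Hd H1]].
  { assert (A := inv_INR_pos n). lra. }
  (* The bound 1 keeps out the extra broom at [x = -2], since the disk planes have [x >= -1]. *)
  exists (Rmin d 1). split; [apply Rmin_pos; lra|]. intros y Hy Hyd.
  assert (D1 := Rlt_le_trans _ _ _ Hyd (Rmin_l _ _)).
  assert (D2 := Rlt_le_trans _ _ _ Hyd (Rmin_r _ _)).
  destruct (proj1 (space_cases a o y) Hy) as [[x [_ ->]] | [[k [q [Hq ->]]] | [_ [q [_ ->]]]]].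
  - rewrite unplane_axis. split; auto. apply HH. left. apply disk_center.
  - rewrite p1_plane in *. assert (E := H1 k D1).
    assert (k = n) as ->. { apply inv_INR_inj. lra. }
    rewrite unplane_plane. split; auto. tauto.
  - exfalso. unfold p1 in D2. cbn [fst snd] in D2.
    assert (B := inv_INR_le_1 n). apply Rabs_def2 in D2. lra.
Qed.

Lemma space_extra_slab o y : space true o y -> Rabs (p1 y - -2) < 1 ->
  broom (p2 y, p3 y) /\ (p1 y <> -2 -> (p2 y, p3 y) = (0, 0)).
Proof.
  intros Hy Hd.
  destruct (proj1 (space_cases true o y) Hy) as [[x [_ ->]] | [[k [q [Hq ->]]] | [_ [q [Hq ->]]]]].
  - unfold p2, p3. cbn [fst snd]. split; auto. apply broom_center.
  - exfalso. rewrite p1_plane in Hd. assert (B := inv_INR_le_1 k).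
    apply Rabs_def2 in Hd. lra.
  - unfold p1, p2, p3. cbn [fst snd]. rewrite <- surjective_pairing. split; auto. tauto.
Qed.

Definition hair_part (j : hair_index) (r : pt3) : pt2 :=
  match j with
  | Some (i, n) =>
      if Req_dec_T (p1 r) (- / INR (S n)) then broom_part e i (unplane n r) else (0, 0)
  | None => if Req_dec_T (p1 r) (-2) then (p2 r, p3 r) else (0, 0)
  end.

(** Near the plane of the [n]-th disk the only other points lie on the axis, where
    [broom_part] of the rescaled point is also the centre. *)
Lemma hair_part_near a o i n y : space a o y -> p1 y = - / INR (S n) ->
  exists d, 0 < d /\ forall y', space a o y' -> d3 y y' < d ->
    H (unplane n y') /\ hair_part (Some (i, n)) y' = broom_part e i (unplane n y').
Proof.
  intros Hy Ey. destruct (space_slab a o n) as [d [Hd H1]].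
  exists d. split; auto. intros y' Hy' Hyy'.
  destruct (H1 y' Hy') as [A B].
  { rewrite <- Ey, Rabs_minus_sym. eapply Rle_lt_trans; [apply d3_p1 | exact Hyy']. }
  split; auto. cbn [hair_part]. destruct Req_dec_T as [E | E]; auto.
  rewrite B; auto. symmetry. apply (broom_part_disk m); auto. apply disk_center.
Qed.

Lemma hair_part_cont_far (a o : bool) (x0 : R) (h : pt3 -> pt2) y :
  p1 y <> x0 ->
  cont_at d3 d2 (space a o) (fun r => if Req_dec_T (p1 r) x0 then h r else (0, 0)) y.
Proof.
  intros Ey. apply cont_at_eq_near with (h := fun _ => (0, 0)) (r := Rabs (p1 y - x0)).
  - cont.
  - apply Rabs_pos_lt. lra.
  - destruct Req_dec_T; tauto.
  - intros y' _ Hd. destruct Req_dec_T as [E | E]; auto. exfalso.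
    assert (A := Rle_lt_trans _ _ _ (d3_p1 y y') Hd). rewrite E in A. lra.
Qed.

Lemma hair_bristle a o j : allowed a j -> bristle d3 (space a o) (hair j) (hair_part j).
Proof.
  intros Hj.
  assert (Hin : forall p, broom p -> space a o (hair j p)) by (right; eauto).
  split; [exact Hin|]. split; [apply hair_cont|].
  destruct j as [[i n] |].
  - destruct (Hbristle i) as [_ [_ [R1 [R2 [ER RE]]]]].
    assert (Hu : forall y, space a o y -> p1 y = - / INR (S n) -> H (unplane n y)).
    { intros y Hy Ey. destruct (hair_part_near a o i n y Hy Ey) as [d [Hd H1]].
      apply H1; auto. now rewrite d3_refl. }
    split; [|split; [|split]].
    + intros y Hy. cbn [hair_part]. destruct Req_dec_T; [now apply R1, Hu | apply broom_center].
    + intros y Hy. change (cont_at d3 d2 (space a o) (hair_part (Some (i, n))) y).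
      destruct (Req_dec_T (p1 y) (- / INR (S n))) as [Ey | Ey].
      * destruct (hair_part_near a o i n y Hy Ey) as [d [Hd H1]].
        apply cont_at_local with (r := d); auto.
        apply cont_at_eq with (h := fun r => broom_part e i (unplane n r)).
        -- split; auto. now rewrite d3_refl.
        -- apply (cont_at_comp d3 d2 d2 _ H (unplane n) (broom_part e i)).
           ++ unfold unplane, Rdiv. cont.
           ++ intros y' [A B]. now apply H1.
           ++ intros eps He. apply R2; auto.
        -- intros y' [A B]. now apply H1.
      * now apply hair_part_cont_far.
    + intros p Hp. cbn [hair hair_part]. rewrite p1_plane, unplane_plane.
      destruct Req_dec_T; [auto | tauto].
    + intros y Hy. cbn [hair hair_part]. destruct Req_dec_T as [E | E]; [|tauto].
      intros Hn. rewrite <- (RE (unplane n y)); auto. now rewrite plane_unplane.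
  - assert (a = true) as -> by now apply Hj.
    assert (Hp : forall y, space true o y -> Rabs (p1 y - -2) < 1 ->
              broom (p2 y, p3 y) /\ hair_part None y = (p2 y, p3 y)).
    { intros y Hy Hd. destruct (space_extra_slab o y Hy Hd) as [A B].
      split; auto. cbn [hair_part]. destruct Req_dec_T; auto. symmetry; auto. }
    assert (Hp' : forall y, p1 y = -2 -> Rabs (p1 y - -2) < 1).
    { intros y ->. rewrite Rminus_diag, Rabs_R0. lra. }
    split; [|split; [|split]].
    + intros y Hy. cbn [hair_part]. destruct Req_dec_T; [now apply Hp; auto | apply broom_center].
    + intros y Hy. change (cont_at d3 d2 (space true o) (hair_part None) y).
      destruct (Req_dec_T (p1 y) (-2)) as [Ey | Ey].
      * apply cont_at_eq_near with (h := fun r => (p2 r, p3 r)) (r := 1).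
        -- cont.
        -- lra.
        -- now apply Hp; auto.
        -- intros y' Hy' Hd. apply Hp; auto. rewrite Rabs_minus_sym, <- Ey.
           eapply Rle_lt_trans; [apply d3_p1 | exact Hd].
      * now apply hair_part_cont_far.
    + intros p Hb. cbn [hair hair_part]. unfold p1, p2, p3. cbn [fst snd].
      destruct Req_dec_T; [symmetry; apply surjective_pairing | tauto].
    + intros y Hy. cbn [hair hair_part]. destruct Req_dec_T as [E | E]; [|tauto].
      intros _. destruct y as [[x y] z]. unfold p1, p2, p3 in *. cbn [fst snd] in *. now subst.
Qed.

Lemma p1_hair j p : p1 (hair j p) = match j with Some (_, n) => - / INR (S n) | None => -2 end.
Proof. now destruct j as [[i n] |]. Qed.

Lemma small_hairs_axis x0 : x0 <> 0 -> x0 <> -2 -> (forall n, x0 <> - / INR (S n)) ->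
  exists d, 0 < d /\ forall z j q, p1 z = x0 -> d3 z (hair j q) < d -> False.
Proof.
  intros H0 H2 Hn. destruct (plane_isolated x0 H0) as [d [Hd H1]].
  exists (Rmin d (Rabs (x0 - -2))). split.
  { apply Rmin_pos; auto. apply Rabs_pos_lt. lra. }
  intros z j q Hz Hlt. assert (A := Rle_lt_trans _ _ _ (d3_p1 _ _) Hlt).
  rewrite Hz, p1_hair in A. destruct j as [[i n] |].
  - apply (Hn n). symmetry. apply H1. rewrite Rabs_minus_sym.
    eapply Rlt_le_trans; [exact A | apply Rmin_l].
  - assert (B := Rlt_le_trans _ _ _ A (Rmin_r _ _)). lra.
Qed.

Lemma small_hairs_origin eps : 0 < eps -> exists d, 0 < d /\ forall j q, broom q ->
  d3 (0, 0, 0) (hair j q) < d -> forall q', broom q' -> d3 (0, 0, 0) (hair j q') < eps.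
Proof.
  (* The bound 1 excludes the extra broom. For the others [eps / 2] bounds [/ INR (S n)], and the
     hairy disk of that diameter lies within twice this number of the origin. *)
  intros He. exists (Rmin 1 (eps / 2)). split; [apply Rmin_pos; lra|].
  intros j q Hq Hd q' Hq'.
  assert (A := Rle_lt_trans _ _ _ (d3_p1 _ _) Hd). rewrite p1_hair in A.
  unfold p1 in A. cbn [fst snd] in A.
  assert (A1 := Rlt_le_trans _ _ _ A (Rmin_l _ _)).
  assert (A2 := Rlt_le_trans _ _ _ A (Rmin_r _ _)). clear A Hd.
  destruct j as [[i n] |].
  - assert (B := inv_INR_pos n). rewrite Rabs_pos_eq in A1, A2 by lra.
    assert (T := d3_triangle (0, 0, 0) (plane n (0, 0)) (plane n (e i q'))).
    rewrite plane_dist in T. cbn [hair].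
    assert (T1 : d3 (0, 0, 0) (plane n (0, 0)) <= / INR (S n)).
    { eapply Rle_trans; [apply d3_le|]. unfold plane, p1, p2, p3. cbn [fst snd].
      rewrite !Rmult_0_r, d2_refl, Rabs_pos_eq; lra. }
    assert (T2 : scale n * d2 (0, 0) (e i q') <= / INR (S n)).
    { transitivity (scale n * D).
      - apply Rmult_le_compat_l; [left; apply scale_pos|].
        apply diameter_bound; apply HH; [left; apply disk_center | right; eauto].
      - right. unfold scale. assert (P := D_pos). assert (Q := INR_S_pos n). field. lra. }
    lra.
  - apply Rabs_def2 in A1. lra.
Qed.

Lemma small_hairs_disk n p : disk2 p -> (forall i, p <> m i) -> forall eps, 0 < eps ->
  exists d, 0 < d /\ forall j q, broom q -> d3 (plane n p) (hair j q) < d ->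
    forall q', broom q' -> d3 (plane n p) (hair j q') < eps.
Proof.
  intros Hp Hnc eps He. assert (Hs := scale_pos n).
  destruct (small_hairs m e Hemb Hdisk Hdiam p Hp Hnc (eps / scale n)) as [d [Hd H1]].
  { now apply Rdiv_lt_0_compat. }
  destruct (plane_isolated (- / INR (S n))) as [c [Hc H2]].
  { assert (A := inv_INR_pos n). lra. }
  assert (Hds : 0 < scale n * d) by now apply Rmult_lt_0_compat.
  exists (Rmin (Rmin c 1) (scale n * d)). split; [repeat apply Rmin_pos; auto; lra|].
  intros j q Hq Hlt q' Hq'.
  assert (A := Rle_lt_trans _ _ _ (d3_p1 _ _) Hlt). rewrite p1_hair, p1_plane in A.
  assert (A' := Rlt_le_trans _ _ _ A (Rmin_l _ _)).
  assert (A1 := Rlt_le_trans _ _ _ A' (Rmin_l _ _)).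
  assert (A2 := Rlt_le_trans _ _ _ A' (Rmin_r _ _)).
  assert (A3 := Rlt_le_trans _ _ _ Hlt (Rmin_r _ _)). clear A A' Hlt.
  destruct j as [[i k] |]; cbn [hair] in *.
  - assert (k = n) as ->.
    { apply inv_INR_inj. rewrite Rabs_minus_sym in A1. specialize (H2 k A1). lra. }
    rewrite plane_dist in *. apply Rmult_lt_reg_l in A3; auto.
    specialize (H1 i q Hq A3 q' Hq').
    apply Rmult_lt_compat_l with (r := scale n) in H1; auto.
    replace (scale n * (eps / scale n)) with eps in H1 by (field; lra). exact H1.
  - exfalso. assert (B := inv_INR_le_1 n). apply Rabs_def2 in A2. lra.
Qed.

Lemma small_hairs_trunk a o z : trunk a o z ->
  (forall j q, allowed a j -> broom q -> z = hair j q -> False) ->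
  forall eps, 0 < eps -> exists d, 0 < d /\ forall j q, allowed a j -> broom q ->
     d3 z (hair j q) < d -> forall q', broom q' -> d3 z (hair j q') < eps.
Proof.
  intros Hz Hnc eps He.
  assert (Hpl : forall n p, z = plane n p -> disk2 p ->
    exists d, 0 < d /\ forall j q, allowed a j -> broom q ->
     d3 z (hair j q) < d -> forall q', broom q' -> d3 z (hair j q') < eps).
  { intros n p -> Hp. destruct (small_hairs_disk n p Hp) with (eps := eps) as [d [Hd H1]]; auto.
    { intros i ->. apply (Hnc (Some (i, n)) (0, 0)).
      - intros ?; discriminate.
      - apply broom_center.
      - cbn [hair]. now rewrite Hcent. }
    exists d. split; auto. intros j q _ Hq Hlt. exact (H1 j q Hq Hlt). }
  destruct Hz as [[x [Hx ->]] | [n [p [Hp ->]]]]; [|now apply (Hpl n p)].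
  destruct (classic (exists n, x = - / INR (S n))) as [[n ->] | Hn].
  { apply (Hpl n (0, 0)); [|apply disk_center].
    unfold plane. cbn [fst snd]. rewrite Rmult_0_r. reflexivity. }
  destruct (Req_dec x 0) as [-> | H0].
  { destruct (small_hairs_origin eps He) as [d [Hd H1]]. exists d. split; auto.
    intros j q _ Hq Hlt. exact (H1 j q Hq Hlt). }
  assert (H2 : x <> -2).
  { intros ->. destruct a.
    - apply (Hnc None (0, 0)); [now intros _ | apply broom_center | reflexivity].
    - destruct Hx as [Hx _]. lra. }
  destruct (small_hairs_axis x H0 H2) as [d [Hd H1]].
  { intros n E. apply Hn. now exists n. }
  exists d. split; auto. intros j q _ _ Hlt. exfalso. apply (H1 (x, 0, 0) j q); auto.
Qed.

(** Until time 1/2 the disks shrink to their centres while the axis rests; afterwards the axis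
    slides to [x0]. The truncations by [Rmax] put both phases into one evidently continuous
    formula. *)
Definition trunk_push (x0 t : R) (r : pt3) : pt3 :=
  (p1 r + Rmax 0 (2 * t - 1) * (x0 - p1 r), Rmax 0 (1 - 2 * t) * p2 r,
   Rmax 0 (1 - 2 * t) * p3 r).

Lemma trunk_push_path_family a o z : trunk a o z ->
  path_family d3 d3 (trunk a o) z (space a o) (trunk_push (p1 z)).
Proof.
  intros Hz. apply path_family_of_joint; auto.
  - apply d3_refl.
  - intros t r Ht Hr. unfold unit_interval in Ht. left. unfold trunk_push.
    destruct (Rle_dec t (1 / 2)) as [L | L].
    + rewrite (Rmax_left 0 (2 * t - 1)), (Rmax_right 0 (1 - 2 * t)) by lra.
      rewrite Rmult_0_l, Rplus_0_r.
      destruct Hr as [[x [Hx ->]] | [n [p [Hp ->]]]].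
      * left. exists x. split; auto. unfold p1, p2, p3. cbn [fst snd].
        now rewrite Rmult_0_r.
      * right. exists n, ((1 - 2 * t) * fst p, (1 - 2 * t) * snd p). split.
        -- unfold disk2 in *. cbn [fst snd].
           replace (((1 - 2 * t) * fst p) ^ 2 + ((1 - 2 * t) * snd p) ^ 2)
             with ((1 - 2 * t) ^ 2 * (fst p ^ 2 + snd p ^ 2)) by ring.
           assert (A := pow2_ge_0 (fst p)). assert (B := pow2_ge_0 (snd p)).
           assert (0 <= (1 - 2 * t) ^ 2 <= 1) by nra. nra.
        -- unfold plane, p1, p2, p3. cbn [fst snd]. f_equal; [f_equal|]; ring.
    + rewrite (Rmax_right 0 (2 * t - 1)), (Rmax_left 0 (1 - 2 * t)) by lra.
      left. eexists. split; [|rewrite !Rmult_0_l; reflexivity].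
      apply axis_convex; [now apply trunk_axis | now apply trunk_axis | lra].
  - intros t r Ht Hr. unfold trunk_push. cont.
Qed.

Lemma space_pushable a o z : space a o z ->
  (forall j, allowed a j -> z <> hair j (0, 0)) -> locally_pushable (space a o) z.
Proof.
  intros Hz Hnc.
  destruct (classic (exists j q, allowed a j /\ broom q /\ z = hair j q))
    as [[j [q [Hj [Hq ->]]]] | N].
  - apply bristle_pushable with (rho := hair_part j); auto.
    + now apply hair_bristle.
    + intros ->. now apply (Hnc j).
  - assert (Ht : trunk a o z).
    { destruct Hz as [Hz | Hz]; auto. exfalso. auto. }
    assert (N' : forall j q, allowed a j -> broom q -> z = hair j q -> False).
    { intros j q A B C. apply N. eauto. }
    apply (trunk_pushable (allowed a) hair (space a o) (trunk a o)) with
      (G := trunk_push (p1 z)); auto.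
    + intros y. split; auto.
    + intros j _. apply hair_cont.
    + intros j Hj. now apply hair_center_trunk.
    + now apply (small_hairs_trunk a o).
    + now apply trunk_push_path_family.
    + intros y Hy. unfold trunk_push.
      rewrite (Rmax_left 0 (2 * 0 - 1)), (Rmax_right 0 (1 - 2 * 0)),
        (Rmax_right 0 (2 * 1 - 1)), (Rmax_left 0 (1 - 2 * 1)) by lra.
      destruct y as [[y1 y2] y3]. unfold p1, p2, p3. cbn [fst snd].
      split; (f_equal; [f_equal|]; ring).
Qed.

(** * Matching the broom centres of the two spaces *)

Lemma equivalence_maps_centers a o a' o' f g j :
  cmap (space a o) (space a' o') f -> cmap (space a' o') (space a o) g ->
  homotopic (space a o) (space a o) (compose g f) (fun x => x) -> allowed a j ->
  g (f (hair j (0, 0))) = hair j (0, 0) /\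
  exists j', allowed a' j' /\ f (hair j (0, 0)) = hair j' (0, 0).
Proof.
  intros Hf Hg Hh Hj. assert (HB := hair_bristle a o j Hj). split.
  - exact (homotopic_id_fixes_center _ _ _ _ HB Hh).
  - apply NNPP. intros N. apply (center_image_not_pushable _ _ _ _ _ _ HB Hf Hg Hh).
    apply space_pushable.
    + apply Hf, HB, broom_center.
    + intros j' Hj' E. apply N. eauto.
Qed.

(** Let [c] be the extra centre and [w = g c], a centre of the smaller space with [f w = c]. Another
    centre close enough to [w] is also sent to [c] by [f]; applying [g] identifies it with [w], a
    contradiction. *)
Lemma space_not_homotopy_equivalent o :
  ~ homotopy_equivalent (space false o) (space true o).
Proof.
  intros [f [g [Hf [Hg [Hgf Hfg]]]]].
  assert (Hn : allowed true None) by now intros _.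
  destruct (equivalence_maps_centers true o false o g f None Hg Hf Hfg Hn)
    as [Efg [[[i n] |] [Hj Eg]]]; [|now specialize (Hj eq_refl)].
  assert (Hw : space false o (hair (Some (i, n)) (0, 0))).
  { rewrite <- Eg. apply Hg. right. exists None, (0, 0). auto using broom_center. }
  destruct Hf as [Hf1 Hf2].
  (* All centres except the extra one have first coordinate at least -1, hence distance at least 1
     from it. *)
  destruct (Hf2 _ Hw 1 Rlt_0_1) as [d [Hd H1]].
  rewrite <- Eg, Efg in H1.
  destruct (centers_not_isolated m Hm Hdense i (d / scale n)) as [k [Hk Hmk]].
  { apply Rdiv_lt_0_compat; auto. apply scale_pos. }
  assert (Ha : allowed false (Some (k, n))) by (intros ?; discriminate).
  destruct (equivalence_maps_centers false o true o f g (Some (k, n))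
              (conj Hf1 Hf2) Hg Hgf Ha) as [Egf [j' [Hj' Ef]]].
  assert (Hd1 : d3 (hair None (0, 0)) (f (hair (Some (k, n)) (0, 0))) < 1).
  { apply H1.
    - right. exists (Some (k, n)), (0, 0). auto using broom_center.
    - rewrite Eg. cbn [hair]. rewrite plane_dist, !Hcent. assert (S := scale_pos n).
      apply Rmult_lt_compat_l with (r := scale n) in Hmk; auto.
      replace (scale n * (d / scale n)) with d in Hmk by (field; lra). exact Hmk. }
  assert (j' = None) as ->.
  { destruct j' as [[i' n'] |]; auto. exfalso. rewrite Ef in Hd1.
    assert (A := Rle_lt_trans _ _ _ (d3_p1 _ _) Hd1). rewrite !p1_hair in A.
    assert (B := inv_INR_le_1 n'). apply Rabs_def2 in A. lra. }
  rewrite Ef, Eg in Egf. cbn [hair] in Egf. apply plane_inj in Egf.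
  rewrite !Hcent in Egf. apply Hk.
  symmetry. exact (m_inj m e Hcent Hdisj i k Egf).
Qed.

End Spaces.

(** * Domination in both directions *)

Lemma homotopic_of_eq (X : pt3 -> Prop) (h : pt3 -> pt3) :
  (forall x, X x -> h x = x) -> homotopic X X h (fun x => x).
Proof.
  intros Hh. exists (fun _ x => x). split; [|split].
  - auto.
  - intros t x _ _ eps He. exists eps. auto.
  - intros x Hx. now rewrite Hh.
Qed.

Lemma homotopic_of_cont (X : pt3 -> Prop) (K : R -> pt3 -> pt3) (f g : pt3 -> pt3) :
  (forall t x, 0 <= t <= 1 -> X x -> X (K t x)) ->
  (forall t x, unit_interval t -> X x ->
     cont_at (dprod d3) d3 (cylinder X) (fun a => K (fst a) (snd a)) (t, x)) ->
  (forall x, X x -> K 0 x = f x /\ K 1 x = g x) -> homotopic X X f g.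
Proof.
  intros K1 K2 K3. exists K. split; [|split]; auto.
  intros t x Ht Hx eps He. destruct (K2 t x Ht Hx eps He) as [d [Hd H1]].
  exists d. split; auto. intros t' y Ht' Hy Htt Hxy.
  apply (H1 (t', y)); [split; auto | apply Rmax_lub_lt; auto].
Qed.

Lemma triple_eq (x y z x' y' z' : R) :
  x = x' -> y = y' -> z = z' -> (x, y, z) = (x', y', z').
Proof. now intros -> -> ->. Qed.

Lemma Rdiv_one_minus_bounds x : x <= 0 -> -1 < x / (1 - x) <= 0 /\ x <= x / (1 - x).
Proof.
  intros Hx.
  assert (E : x / (1 - x) * (1 - x) = x) by (field; lra).
  set (y := x / (1 - x)) in *. clearbody y. split; [split|]; nra.
Qed.

Section HEqual.
Context (H : pt2 -> Prop) (m : nat -> pt2) (e : nat -> pt2 -> pt2) (D : R).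
Context (Hm : forall i, circle2 (m i))
  (Hemb : forall i, embedding2 broom (e i))
  (Hcent : forall i, e i (0, 0) = m i)
  (Hdisj : forall i j p q, i <> j -> broom p -> broom q -> e i p <> e j q)
  (Hdisk : forall i p, broom p -> disk2 (e i p) -> e i p = m i)
  (Hdiam : forall eps, 0 < eps -> exists N, forall i, (N <= i)%nat ->
       forall p q, broom p -> broom q -> d2 (e i p) (e i q) < eps)
  (HH : forall r, H r <-> disk2 r \/ exists i p, broom p /\ r = e i p)
  (HD : is_diameter H D).

Let Sp := space e D.
Let cases := space_cases H e D HH.
Let Dpos := D_pos H e D HH HD.

(** A retraction to the smaller space: the factor [p1 r + 2] vanishes at [x = -2] and flattens the
    extra broom to its centre, and the clamp squeezes the arc to the point with [x = -1]. *)
Definition collapse_extra (r : pt3) : pt3 :=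
  (Rmax (p1 r) (-1), Rmin 1 (p1 r + 2) * p2 r, Rmin 1 (p1 r + 2) * p3 r).

Lemma collapse_extra_id r : -1 <= p1 r -> collapse_extra r = r.
Proof.
  intros Hr. unfold collapse_extra. rewrite Rmax_left, Rmin_left by lra.
  destruct r as [[x y] z]. unfold p1, p2, p3. cbn [fst snd]. now rewrite !Rmult_1_l.
Qed.

Lemma p1_small_space o r : Sp false o r -> -1 <= p1 r.
Proof.
  intros Hr. destruct (proj1 (cases false o r) Hr)
    as [[x [[Hx _] ->]] | [[n [q [_ ->]]] | [Ha _]]]; [exact Hx | | discriminate].
  rewrite p1_plane. assert (A := inv_INR_le_1 n). lra.
Qed.

Lemma axis_widen o x : axis false o x -> axis true o x.
Proof. intros [A B]. split; auto. lra. Qed.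

Lemma space_widen o r : Sp false o r -> Sp true o r.
Proof.
  intros Hr. apply cases. destruct (proj1 (cases false o r) Hr)
    as [[x [Hx ->]] | [[n [q [Hq ->]]] | [Ha _]]].
  - left. exists x. split; auto. now apply axis_widen.
  - right; left; eauto.
  - discriminate.
Qed.

Lemma collapse_extra_cmap o : cmap (Sp true o) (Sp false o) collapse_extra.
Proof.
  split.
  - intros r Hr. apply cases. destruct (proj1 (cases true o r) Hr)
      as [[x [[Hx Hx'] ->]] | [[n [q [Hq ->]]] | [_ [q [_ ->]]]]].
    + left. exists (Rmax x (-1)). split.
      * split; [apply Rmax_r|]. unfold Rmax. destruct Rle_dec; auto; left; lra.
      * unfold collapse_extra, p1, p2, p3. cbn [fst snd]. now rewrite !Rmult_0_r.
    + right; left. exists n, q. split; auto. apply collapse_extra_id.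
      rewrite p1_plane. assert (A := inv_INR_le_1 n). lra.
    + left. exists (-1). split; [split; [lra | left; lra]|].
      unfold collapse_extra, p1, p2, p3. cbn [fst snd].
      rewrite Rmax_right, Rmin_right by lra. apply triple_eq; ring.
  - intros r Hr. change (cont_at d3 d3 (Sp true o) collapse_extra r).
    unfold collapse_extra. cont.
Qed.

Lemma small_space_dominated o :
  exists f g, cmap (Sp false o) (Sp true o) f /\ cmap (Sp true o) (Sp false o) g /\
    homotopic (Sp false o) (Sp false o) (compose g f) (fun x => x).
Proof.
  exists (fun r => r), collapse_extra. split; [|split].
  - split; [apply space_widen|]. intros r _. exact (cont_at_id d3 (Sp false o) r).
  - apply collapse_extra_cmap.
  - apply homotopic_of_eq. intros r Hr. apply collapse_extra_id.
    now apply (p1_small_space o).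
Qed.

(** [shift] moves every disk to the next one and the extra broom to the broom at [m 0] of the
    first disk; [unshift] inverts this, collapsing the rest of the first hairy disk. *)
Definition shift (r : pt3) : pt3 :=
  if Rle_dec (p1 r) (-3 / 2) then
    (-1, scale D 0 * (fst (e 0 (p2 r, p3 r)) + (-4 - 2 * p1 r) * fst (m 0)),
     scale D 0 * (snd (e 0 (p2 r, p3 r)) + (-4 - 2 * p1 r) * snd (m 0)))
  else
    let M := Rmax (p1 r) (-1) in
    (M / (1 - M) + (p1 r - M), p2 r / (1 - M), p3 r / (1 - M)).

Definition unshift (r : pt3) : pt3 :=
  if Rle_dec (p1 r) (-3 / 4) then
    (2 * p1 r, fst (broom_part e 0 (unplane D 0 r)), snd (broom_part e 0 (unplane D 0 r)))
  else
    let M := Rmax (p1 r) (- / 2) in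
    (M / (1 + M) + 2 * (p1 r - M), p2 r / (1 + M), p3 r / (1 + M)).

Lemma shift_extra q : shift (-2, fst q, snd q) = plane D 0 (e 0 q).
Proof.
  unfold shift, p1, p2, p3. cbn [fst snd]. destruct Rle_dec; [|lra].
  rewrite <- surjective_pairing. unfold plane. cbn [INR]. rewrite Rinv_1.
  apply triple_eq; ring.
Qed.

(** The outer half of the arc runs along a radius of the first disk: the coefficient falls from 1 at
    [x = -2], giving [m 0], to 0 at [x = -3 / 2], giving the disk centre. *)
Lemma shift_arc x : x <= -3 / 2 ->
  shift (x, 0, 0) = plane D 0 ((-3 - 2 * x) * fst (m 0), (-3 - 2 * x) * snd (m 0)).
Proof.
  intros Hx. unfold shift, p1, p2, p3. cbn [fst snd]. destruct Rle_dec; [|lra].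
  rewrite Hcent. unfold plane. cbn [INR fst snd]. rewrite Rinv_1.
  apply triple_eq; ring.
Qed.

(** The inner half of the arc covers the segment between the first two disk centres. *)
Lemma shift_axis_mid x : -3 / 2 < x <= -1 -> shift (x, 0, 0) = (x + / 2, 0, 0).
Proof.
  intros Hx. unfold shift, p1, p2, p3. cbn [fst snd]. destruct Rle_dec; [lra|].
  cbv zeta. rewrite Rmax_right by lra. apply triple_eq; field.
Qed.

Lemma shift_axis x : -1 <= x <= 0 -> shift (x, 0, 0) = (x / (1 - x), 0, 0).
Proof.
  intros Hx. unfold shift, p1, p2, p3. cbn [fst snd]. destruct Rle_dec; [lra|].
  cbv zeta. rewrite Rmax_left by lra. apply triple_eq; field; lra.
Qed.

(** The function [x / (1 - x)] takes [-1/k] to [-1/(k+1)], and [1 / (1 - x)] is then [k/(k+1)], the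
    ratio of the two scales. *)
Lemma shift_plane n q : shift (plane D n q) = plane D (S n) q.
Proof.
  assert (A := inv_INR_le_1 n). assert (B := INR_S_pos n).
  unfold shift. rewrite p1_plane. destruct Rle_dec; [lra|].
  cbv zeta. rewrite Rmax_left by lra.
  unfold plane, scale, p2, p3. cbn [fst snd].
  rewrite (S_INR (S n)). apply triple_eq; field; lra.
Qed.

Lemma unshift_disk q : unshift (plane D 0 q) =
  (-2, fst (broom_part e 0 q), snd (broom_part e 0 q)).
Proof.
  unfold unshift. rewrite p1_plane. cbn [INR]. destruct Rle_dec; [|lra].
  rewrite (unplane_plane H e D HH HD). f_equal; f_equal. rewrite Rinv_1. ring.
Qed.

(** Axis points project to the disk centre, whose broom part is the broom centre, so both branches
    reduce to doubling. *)
Lemma unshift_arc x : -1 <= x <= - / 2 -> unshift (x, 0, 0) = (2 * x, 0, 0).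
Proof.
  intros Hx. unfold unshift. destruct Rle_dec as [L | L].
  - rewrite (unplane_axis H e D HH HD), (broom_part_disk m) by auto using disk_center.
    reflexivity.
  - unfold p1, p2, p3 in *. cbn [fst snd] in *. cbv zeta.
    rewrite Rmax_right by lra. apply triple_eq; field.
Qed.

Lemma unshift_axis x : - / 2 <= x -> unshift (x, 0, 0) = (x / (1 + x), 0, 0).
Proof.
  intros Hx. unfold unshift, p1, p2, p3. cbn [fst snd]. destruct Rle_dec; [lra|].
  cbv zeta. rewrite Rmax_left by lra. apply triple_eq; field; lra.
Qed.

Lemma inv_INR_SS_le n : / INR (S (S n)) <= / 2.
Proof.
  apply Rinv_le_contravar; [lra|]. rewrite !S_INR. assert (A := pos_INR n). lra.
Qed.

Lemma unshift_plane n q : unshift (plane D (S n) q) = plane D n q.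
Proof.
  assert (A := inv_INR_SS_le n). assert (B := INR_S_pos n).
  unfold unshift. rewrite p1_plane. destruct Rle_dec; [lra|].
  cbv zeta. rewrite Rmax_left by lra.
  unfold plane, scale, p2, p3. cbn [fst snd].
  rewrite (S_INR (S n)). apply triple_eq; field; lra.
Qed.

Lemma shift_cmap o : cmap (Sp true o) (Sp false o) shift.
Proof.
  split.
  - intros r Hr. apply cases. destruct (proj1 (cases true o r) Hr)
      as [[x [[Hx Hx'] ->]] | [[n [q [Hq ->]]] | [_ [q [Hq ->]]]]].
    + destruct (Rle_dec x (-3 / 2)) as [L | L]; [|destruct (Rle_dec x (-1)) as [L' | L']].
      * right; left. rewrite shift_arc by auto. eexists 0%nat, _. split; [|reflexivity].
        apply HH. left. assert (C := Hm 0). unfold disk2, circle2 in *. cbn [fst snd].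
        replace (((-3 - 2 * x) * fst (m 0)) ^ 2 + ((-3 - 2 * x) * snd (m 0)) ^ 2)
          with ((-3 - 2 * x) ^ 2 * (fst (m 0) ^ 2 + snd (m 0) ^ 2)) by ring.
        rewrite C. nra.
      * left. rewrite shift_axis_mid by lra. eexists. split; [|reflexivity].
        split; [lra | left; lra].
      * left. assert (x <= 0) by (destruct Hx' as [? | [_ ?]]; lra).
        rewrite shift_axis by lra. eexists. split; [|reflexivity].
        destruct (Rdiv_one_minus_bounds x) as [B1 B2]; auto. split; [lra|].
        destruct Hx' as [? | [? ->]]; [left | right; split; auto; field].
        apply Rmult_lt_reg_r with (1 - x); [lra|]. field_simplify; lra.
    + right; left. rewrite shift_plane. eauto.
    + right; left. rewrite shift_extra. exists 0%nat, (e 0 q). split; auto.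
      apply HH. right. eauto.
  - intros r Hr. change (cont_at d3 d3 (Sp true o) shift r).
    (* The cut meets the space only in [(-3 / 2, 0, 0)], which both formulas send to the centre of
       the first disk. *)
    apply cont_glue with (phi := p1) (c := -3 / 2)
      (g := fun r =>
         (-1, scale D 0 * (fst (e 0 (p2 r, p3 r)) + (-4 - 2 * p1 r) * fst (m 0)),
          scale D 0 * (snd (e 0 (p2 r, p3 r)) + (-4 - 2 * p1 r) * snd (m 0))))
      (h := fun r =>
         (Rmax (p1 r) (-1) / (1 - Rmax (p1 r) (-1)) + (p1 r - Rmax (p1 r) (-1)),
          p2 r / (1 - Rmax (p1 r) (-1)), p3 r / (1 - Rmax (p1 r) (-1)))); auto.
    + cont.
    + intros y _ Hy. unfold shift. now destruct Rle_dec.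
    + intros y Hy Hle. unfold shift. destruct Rle_dec as [L | L]; auto.
      destruct (proj1 (cases true o y) Hy)
        as [[x [_ ->]] | [[n [q [_ ->]]] | [_ [q [_ ->]]]]].
      * unfold p1, p2, p3 in *. cbn [fst snd] in *. assert (x = -3 / 2) as -> by lra.
        rewrite Rmax_right by lra. rewrite Hcent. apply triple_eq; field.
      * rewrite p1_plane in *. assert (A := inv_INR_le_1 n). lra.
      * unfold p1 in Hle. cbn [fst snd] in Hle. lra.
    + intros _.
      assert (C : cont_at d3 d2 (fun y => Sp true o y /\ p1 y <= -3 / 2)
                    (fun y => e 0 (p2 y, p3 y)) r).
      { assert (Hb : forall y, Sp true o y /\ p1 y <= -3 / 2 -> broom (p2 y, p3 y)).
        { intros y [Hy Hle]. destruct (proj1 (cases true o y) Hy)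
            as [[x [_ ->]] | [[n [q [_ ->]]] | [_ [q [Hq ->]]]]].
          - apply broom_center.
          - rewrite p1_plane in *. assert (A := inv_INR_le_1 n). lra.
          - unfold p2, p3. cbn [fst snd]. now rewrite <- surjective_pairing. }
        destruct (Rle_dec (p1 r) (-3 / 2)) as [L | L].
        - apply (cont_at_comp d3 d2 d2 _ broom (fun y => (p2 y, p3 y)) (e 0)); auto.
          + cont.
          + exact (e_cont e Hemb 0 _ (Hb r (conj Hr L))).
        - intros eps He. exists (p1 r - -3 / 2). split; [lra|].
          intros y [_ Hy] Hd. exfalso.
          assert (A := Rle_lt_trans _ _ _ (d3_p1 _ _) Hd). apply Rabs_def2 in A. lra. }
      cont; exact C.
    + intros _.
      assert (C : cont_at d3 dR (fun y => Sp true o y /\ -3 / 2 <= p1 y)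
                    (fun y => / (1 - Rmax (p1 y) (-1))) r).
      { apply cont_inv; [|cont]. assert (p1 r <= 0).
        { destruct (proj1 (cases true o r) Hr)
            as [[x [[_ Hx] ->]] | [[n [q [_ ->]]] | [_ [q [Hq ->]]]]].
          - unfold p1. cbn [fst]. destruct Hx as [? | [_ ?]]; lra.
          - rewrite p1_plane. assert (A := inv_INR_pos n). lra.
          - unfold p1. cbn [fst]. lra. }
        assert (Rmax (p1 r) (-1) <= 0) by (apply Rmax_lub; lra). lra. }
      unfold Rdiv. cont; exact C.
Qed.

Lemma unshift_cmap o : cmap (Sp false o) (Sp true o) unshift.
Proof.
  destruct (hairy_disk_bristle H m e Hm Hemb Hcent Hdisj Hdisk Hdiam HH 0)
    as [_ [_ [R1 [R2 _]]]].
  split.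
  - intros r Hr. apply cases. destruct (proj1 (cases false o r) Hr)
      as [[x [[Hx Hx'] ->]] | [[[|n] [q [Hq ->]]] | [Ha _]]].
    + left. destruct (Rle_dec x (- / 2)) as [L | L].
      * rewrite unshift_arc by lra. eexists. split; [|reflexivity]. split; [lra | left; lra].
      * rewrite unshift_axis by lra. eexists. split; [|reflexivity]. split.
        -- apply Rmult_le_reg_r with (1 + x); [lra|].
           replace (x / (1 + x) * (1 + x)) with x by (field; lra). lra.
        -- destruct Hx' as [? | [? ->]]; [left | right; split; auto; field].
           apply Rmult_lt_reg_r with (1 + x); [lra|].
           replace (x / (1 + x) * (1 + x)) with x by (field; lra). lra.
    + right; right. rewrite unshift_disk. split; auto.
      exists (broom_part e 0 q). split; auto.
    + right; left. rewrite unshift_plane. eauto.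
    + discriminate.
  - intros r Hr. change (cont_at d3 d3 (Sp false o) unshift r).
    (* The cut passes between the first two disk planes and meets the space in one axis point, sent
       to [(-3 / 2, 0, 0)] by both formulas. *)
    apply cont_glue with (phi := p1) (c := -3 / 4)
      (g := fun r => (2 * p1 r, fst (broom_part e 0 (unplane D 0 r)),
                      snd (broom_part e 0 (unplane D 0 r))))
      (h := fun r =>
         (Rmax (p1 r) (- / 2) / (1 + Rmax (p1 r) (- / 2)) + 2 * (p1 r - Rmax (p1 r) (- / 2)),
          p2 r / (1 + Rmax (p1 r) (- / 2)), p3 r / (1 + Rmax (p1 r) (- / 2)))); auto.
    + cont.
    + intros y _ Hy. unfold unshift. now destruct Rle_dec.
    + intros y Hy Hle. unfold unshift. destruct Rle_dec as [L | L]; auto.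
      destruct (proj1 (cases false o y) Hy)
        as [[x [_ ->]] | [[[|n] [q [_ ->]]] | [Ha _]]].
      * rewrite (unplane_axis H e D HH HD), (broom_part_disk m) by auto using disk_center.
        unfold p1, p2, p3 in *. cbn [fst snd] in *. assert (x = -3 / 4) as -> by lra.
        rewrite Rmax_right by lra. apply triple_eq; field.
      * rewrite p1_plane in *. cbn [INR] in *. lra.
      * rewrite p1_plane in *. assert (A := inv_INR_SS_le n). lra.
      * discriminate.
    + intros _.
      assert (C : cont_at d3 d2 (fun y => Sp false o y /\ p1 y <= -3 / 4)
                    (fun y => broom_part e 0 (unplane D 0 y)) r).
      { assert (Hb : forall y, Sp false o y /\ p1 y <= -3 / 4 -> H (unplane D 0 y)).
        { intros y [Hy Hle]. destruct (proj1 (cases false o y) Hy)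
            as [[x [_ ->]] | [[[|n] [q [Hq ->]]] | [Ha _]]].
          - rewrite (unplane_axis H e D HH HD). apply HH. left. apply disk_center.
          - now rewrite (unplane_plane H e D HH HD).
          - rewrite p1_plane in *. assert (A := inv_INR_SS_le n). lra.
          - discriminate. }
        destruct (Rle_dec (p1 r) (-3 / 4)) as [L | L].
        - apply (cont_at_comp d3 d2 d2 _ H (unplane D 0) (broom_part e 0)); auto.
          + unfold unplane, Rdiv. cont.
          + exact (R2 _ (Hb r (conj Hr L))).
        - intros eps He. exists (p1 r - -3 / 4). split; [lra|].
          intros y [_ Hy] Hd. exfalso.
          assert (A := Rle_lt_trans _ _ _ (d3_p1 _ _) Hd). apply Rabs_def2 in A. lra. }
      cont; exact C.
    + intros _.
      assert (C : cont_at d3 dR (fun y => Sp false o y /\ -3 / 4 <= p1 y)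
                    (fun y => / (1 + Rmax (p1 y) (- / 2))) r).
      { apply cont_inv; [|cont]. assert (A := Rmax_r (p1 r) (- / 2)). lra. }
      unfold Rdiv. cont; exact C.
Qed.

(** The effect of [unshift] after [shift] on the axis: [[-2, -3 / 2]], laid along a radius of the
    disk, comes back as the point -2, [[-3 / 2, -1]] is stretched onto [[-2, -1]], and the rest is
    fixed. *)
Definition stretch (x : R) : R := Rmin x (Rmax (-2) (2 * x + 1)).

Lemma stretch_id x : -1 <= x -> stretch x = x.
Proof.
  intros Hx. unfold stretch. apply Rmin_left.
  eapply Rle_trans; [|apply Rmax_r]. lra.
Qed.

Lemma stretch_extra : stretch (-2) = -2.
Proof. unfold stretch. rewrite Rmax_left, Rmin_left; lra. Qed.

Lemma unshift_shift o r : Sp true o r -> unshift (shift r) = (stretch (p1 r), p2 r, p3 r).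
Proof.
  intros Hr. destruct (proj1 (cases true o r) Hr)
    as [[x [[Hx Hx'] ->]] | [[n [q [Hq ->]]] | [_ [q [Hq ->]]]]].
  - change (p1 (x, 0, 0)) with x. change (p2 (x, 0, 0)) with 0. change (p3 (x, 0, 0)) with 0.
    destruct (Rle_dec x (-3 / 2)) as [L | L]; [|destruct (Rle_dec x (-1)) as [L' | L']].
    + rewrite shift_arc, unshift_disk by auto. rewrite (broom_part_disk m); auto.
      * cbn [fst snd]. unfold stretch. rewrite Rmax_left, Rmin_right by lra. reflexivity.
      * assert (C := Hm 0). unfold disk2, circle2 in *. cbn [fst snd].
        replace (((-3 - 2 * x) * fst (m 0)) ^ 2 + ((-3 - 2 * x) * snd (m 0)) ^ 2)
          with ((-3 - 2 * x) ^ 2 * (fst (m 0) ^ 2 + snd (m 0) ^ 2)) by ring.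
        rewrite C. nra.
    + rewrite shift_axis_mid, unshift_arc by lra.
      unfold stretch. rewrite Rmax_right, Rmin_right by lra. f_equal; f_equal. field.
    + assert (x <= 0) by (destruct Hx' as [? | [_ ?]]; lra).
      rewrite shift_axis, stretch_id by lra.
      assert (E : x / (1 - x) * (1 - x) = x) by (field; lra).
      rewrite unshift_axis.
      * f_equal; f_equal. field. split; lra.
      * apply Rmult_le_reg_r with (1 - x); lra.
  - rewrite shift_plane, unshift_plane, p1_plane.
    rewrite stretch_id; [reflexivity|]. assert (A := inv_INR_le_1 n). lra.
  - rewrite shift_extra, unshift_disk.
    rewrite (broom_part_e e Hemb) by auto. unfold p1, p2, p3. cbn [fst snd].
    now rewrite stretch_extra.
Qed.

(** The composite differs from the identity only by a reparametrization of the extra arc fixing its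
    ends, and convexity of the axis permits a straight-line homotopy in the first coordinate. *)
Lemma large_space_dominated o :
  exists f g, cmap (Sp true o) (Sp false o) f /\ cmap (Sp false o) (Sp true o) g /\
    homotopic (Sp true o) (Sp true o) (compose g f) (fun x => x).
Proof.
  exists shift, unshift. split; [apply shift_cmap|]. split; [apply unshift_cmap|].
  apply homotopic_of_cont with
    (K := fun t r => (stretch (p1 r) + t * (p1 r - stretch (p1 r)), p2 r, p3 r)).
  - intros t r Ht Hr. apply cases. destruct (proj1 (cases true o r) Hr)
      as [[x [Hx ->]] | [[n [q [Hq ->]]] | [_ [q [Hq ->]]]]].
    + left. eexists. split; [|reflexivity]. apply axis_convex; auto.
      unfold p1. cbn [fst]. destruct Hx as [Hx Hx']. unfold stretch. split.
      * apply Rmin_glb; auto. apply Rmax_l.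
      * destruct Hx' as [Hx' | [Ho ->]].
        -- left. eapply Rle_lt_trans; [apply Rmin_l | auto].
        -- right. split; auto. rewrite Rmax_right, Rmin_left; lra.
    + right; left. exists n, q. split; auto. rewrite p1_plane, stretch_id.
      * unfold plane, p2, p3. cbn [fst snd]. apply triple_eq; ring.
      * assert (A := inv_INR_le_1 n). lra.
    + right; right. split; auto. exists q. split; auto. unfold p1, p2, p3. cbn [fst snd].
      rewrite stretch_extra. apply triple_eq; ring.
  - intros t r Ht Hr. unfold stretch. cont.
  - intros r Hr. unfold compose. rewrite (unshift_shift o r Hr).
    split; [apply triple_eq; ring|].
    destruct r as [[x y] z]. unfold p1, p2, p3. cbn [fst snd]. apply triple_eq; ring.
Qed.

Lemma space_h_equal o : h_equal (Sp false o) (Sp true o).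
Proof. split; [apply small_space_dominated | apply large_space_dominated]. Qed.

(** * Identification with the spaces of the statement *)

Lemma pred_eq (X Y : pt3 -> Prop) : (forall r, X r <-> Y r) -> X = Y.
Proof.
  intros E. apply functional_extensionality. intros r. now apply propositional_extensionality.
Qed.

Lemma WHo_space : WHo H D = Sp false false.
Proof.
  apply pred_eq. intros r. etransitivity; [|symmetry; apply cases]. unfold WHo. split.
  - intros [[n [q Hq]] | [x [Hx ->]]].
    + right; left. now exists n, q.
    + left. exists x. split; auto. split; [lra | left; lra].
  - intros [[x [[Hx Hx'] ->]] | [[n [q Hq]] | [Ha _]]].
    + right. exists x. split; auto. destruct Hx' as [? | [? _]]; [lra | discriminate].
    + left. now exists n, q.
    + discriminate.
Qed.

Lemma WBHo_space : WBHo H D = Sp true false.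
Proof.
  apply pred_eq. intros r. etransitivity; [|symmetry; apply cases]. unfold WBHo. split.
  - intros [B | [[n [q Hq]] | [x [Hx ->]]]]; auto.
    + right; left. now exists n, q.
    + left. exists x. split; auto. split; [lra | left; lra].
  - intros [[x [[Hx Hx'] ->]] | [[n [q Hq]] | [_ B]]]; auto.
    + right; right. exists x. split; auto. destruct Hx' as [? | [? _]]; [lra | discriminate].
    + right; left. now exists n, q.
Qed.

Lemma space_origin a r : Sp a true r <-> Sp a false r \/ r = (0, 0, 0).
Proof.
  unfold Sp. rewrite !(space_cases H e D HH). split.
  - intros [[x [[Hx [Hx' | [_ ->]]] ->]] | B]; auto.
    left; left. exists x. split; auto. split; auto.
  - intros [[[x [[Hx [Hx' | [E _]]] ->]] | B] | ->]; auto.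
    + left. exists x. split; auto. split; auto.
    + discriminate.
    + left. exists 0. split; auto. split; [destruct a; lra | auto].
Qed.

Lemma WH_space : WH H D = Sp false true.
Proof. apply pred_eq. intros r. rewrite space_origin, <- WHo_space. reflexivity. Qed.

Lemma WBH_space : WBH H D = Sp true true.
Proof. apply pred_eq. intros r. rewrite space_origin, <- WBHo_space. reflexivity. Qed.

End HEqual.

Theorem theorem3p4 (H : pt2 -> Prop) (D : R)
  (hH : is_hairy_disk H) (hD : is_diameter H D) :
  (h_equal (WHo H D) (WBHo H D) /\ ~ homotopy_equivalent (WHo H D) (WBHo H D)) /\
  (h_equal (WH H D) (WBH H D) /\ ~ homotopy_equivalent (WH H D) (WBH H D)).
Proof.
  destruct hH as [m [e [Hm [Hdense [Hemb [Hcent [Hdisj [Hdisk [Hdiam HH]]]]]]]]].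
  rewrite (WHo_space H e D HH), (WBHo_space H e D HH), (WH_space H e D HH),
    (WBH_space H e D HH).
  assert (A := fun o => space_h_equal H m e D Hm Hemb Hcent Hdisj Hdisk Hdiam HH hD o).
  assert (B := fun o => space_not_homotopy_equivalent H m e D Hm Hdense Hemb Hcent Hdisj
                          Hdisk Hdiam HH hD o).
  repeat split; auto; apply A.
Qed.
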